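(* Let $1\le q\le p<\infty$ and $\alpha\in\mathbb{R}$. Then $f\in JNQ^{\alpha}_{p,q}(\mathbb{R}^n)$ if and only if $f$ is measurable on $\mathbb{R}^n$ and $$\|f\|_{\widetilde{JNQ}^{\alpha}_{p,q}(\mathbb{R}^n)}:=\sup_{\ell\in(0,\infty),\,\{Q_j\}_j\in\Pi_\ell}\Big\{\sum_j|Q_j|\,[\Psi_{f,q,\alpha}(Q_j)]^p\Big\}^{1/p}<\infty.$$ Moreover, $\|\cdot\|_{\widetilde{JNQ}^{\alpha}_{p,q}(\mathbb{R}^n)}\sim\|\cdot\|_{JNQ^{\alpha}_{p,q}(\mathbb{R}^n)}$, that is, each of the two quantities is bounded by a positive constant, independent of $f$, times the other.
   Context: Here $n\in\mathbb{N}$, $n\ge1$. A measurable function $f$ on $\mathbb{R}^n$ is a Lebesgue measurable function with $|f|<\infty$ almost everywhere. A cube has finite positive edge length and all its edges parallel to the coordinate axes, and need not be open or closed. For $\ell\in(0,\infty)$, $\Pi_\ell$ is the class of all collections $\{Q_j\}_j$ of cubes of $\mathbb{R}^n$ with pairwise disjoint interiors and equal edge length $\ell$. For $p,q\in[1,\infty)$ and $\alpha\in\mathbb{R}$, the space $JNQ^{\alpha}_{p,q}(\mathbb{R}^n)$ is the set of all measurable $f$ on $\mathbb{R}^n$ with $$\|f\|_{JNQ^\alpha_{p,q}(\mathbb{R}^n)}:=\sup_{\ell\in(0,\infty),\,\{Q_j\}_j\in\Pi_\ell}\Big\{\sum_j|Q_j|\Big[|Q_j|^{\frac{q\alpha}{n}-1}\int_{Q_j}\int_{Q_j}\frac{|f(x)-f(y)|^q}{|x-y|^{n+q\alpha}}\,dy\,dx\Big]^{p/q}\Big\}^{1/p}<\infty.$$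 For a cube $Q$ and $k\in\{0,1,2,\dots\}$, $\mathscr{D}_k(Q)$ is the set of the $2^{kn}$ dyadic subcubes of $Q$ of level $k$ (those with edge length $2^{-k}$ times that of $Q$, obtained from $Q$ by $k$ successive bisections of all edges; $\mathscr{D}_0(Q)=\{Q\}$). For a measurable function $f$, $$\Psi_{f,q,\alpha}(Q):=\Big[\sum_{k=0}^\infty 2^{(q\alpha-n)k}\sum_{I\in\mathscr{D}_k(Q)}\frac1{|I|}\int_I|f(x)-f_I|^q\,dx\Big]^{1/q},$$ where $f_I:=\frac1{|I|}\int_If$, and $\frac1{|I|}\int_I|f(x)-f_I|^q\,dx:=\infty$ if $f\mathbf{1}_I\notin L^1(\mathbb{R}^n)$. *)

(* Defs.v *)
From HB Require Import structures.
From mathcomp Require Import all_boot all_order all_algebra.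
From mathcomp Require Import all_classical all_reals all_analysis.
From mathcomp Require Import measurable_realfun.

Set Implicit Arguments.
Unset Strict Implicit.
Unset Printing Implicit Defensive.
Import Order.TTheory GRing.Theory Num.Theory.
Import numFieldNormedType.Exports.
Local Open Scope classical_set_scope.
Local Open Scope ring_scope.

Section lebesgue_cons.
Local Open Scope ereal_scope.
Context {R : realType} {n : nat}.
Local Notation RR := (measurableTypeR R).

Definition tcons (z : RR * n.-tuple RR) : n.+1.-tuple RR :=
  [tuple of z.1 :: z.2].

Lemma measurable_tcons : measurable_fun [set: _] tcons.
Proof. exact: measurable_cons. Qed.

Variable m : {sigma_finite_measure set (n.-tuple RR) -> \bar R}.

Definition lebesgue_cons : set (n.+1.-tuple RR) -> \bar R :=
  pushforward (@lebesgue_measure R \x m) tcons.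

Let mtcons A : measurable A -> measurable (tcons @^-1` A).
Proof.
by move=> mA; rewrite -[X in measurable X]setTI; exact: measurable_tcons.
Qed.

Let lebesgue_cons0 : lebesgue_cons set0 = 0.
Proof. by rewrite /lebesgue_cons /pushforward preimage_set0 measure0. Qed.

Let lebesgue_cons_ge0 A : 0 <= lebesgue_cons A.
Proof. by rewrite /lebesgue_cons /pushforward; exact: measure_ge0. Qed.

Let lebesgue_cons_sigma_additive : semi_sigma_additive lebesgue_cons.
Proof.
move=> F mF tF mUF; rewrite /lebesgue_cons /pushforward preimage_bigcup.
apply: measure_semi_sigma_additive => [k||].
- exact: mtcons.
- apply/trivIsetP => /= i j _ _ ij; rewrite -preimage_setI.
  by move/trivIsetP : tF => /(_ _ _ _ _ ij) ->//; rewrite preimage_set0.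
- by rewrite -preimage_bigcup; exact: mtcons.
Qed.

HB.instance Definition _ := isMeasure.Build _ _ _ lebesgue_cons
  lebesgue_cons0 lebesgue_cons_ge0 lebesgue_cons_sigma_additive.

Let lebesgue_cons_sigma_finite : sigma_finite setT lebesgue_cons.
Proof.
have /sigma_finiteP[F [TF ndF Foo]] := sigma_finiteT (@lebesgue_measure R).
have /sigma_finiteP[G [TG ndG Goo]] := sigma_finiteT m.
exists (fun k => [set t | F k (thead t) /\ G k [tuple of behead t]]).
  apply/esym; rewrite -subTset => t _.
  have [i _ Fi] : (\bigcup_i F i) (thead t) by rewrite -TF.
  have [j _ Gj] : (\bigcup_i G i) [tuple of behead t] by rewrite -TG.
  exists (maxn i j) => //; split.
    by move: Fi; exact/subsetPset/ndF/leq_maxl.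
  by move: Gj; exact/subsetPset/ndG/leq_maxr.
move=> k; have [mF Fk] := Foo k; have [mG Gk] := Goo k; split.
  apply: measurableI.
    rewrite -[X in measurable X]setTI.
    exact: (@measurable_tnth _ RR n.+1 ord0).
  by rewrite -[X in measurable X]setTI; exact: (@measurable_behead _ RR n).
rewrite /lebesgue_cons /pushforward (_ : _ @^-1` _ = F k `*` G k).
  by rewrite product_measure1E// lte_mul_pinfty// ge0_fin_numE.
apply/funext => -[x t] /=; rewrite theadE.
by congr (_ /\ G k _); exact: val_inj.
Qed.

HB.instance Definition _ := Measure_isSigmaFinite.Build _ _ _ lebesgue_cons
  lebesgue_cons_sigma_finite.

End lebesgue_cons.

(* The n-dimensional Lebesgue measure on the Borel sets of R^n, as the n-fold
   product of the one-dimensional one; R^0 is a point of measure 1. *)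
Fixpoint borel_lebesgue (R : realType) (n : nat) :
    {sigma_finite_measure set (n.-tuple (measurableTypeR R)) -> \bar R} :=
  match n with
  | 0 => \d_([tuple] : 0.-tuple (measurableTypeR R))
  | m.+1 => lebesgue_cons (borel_lebesgue R m)
  end.

(* R^n with the sigma-algebra of its Lebesgue measurable sets, those that are
   Caratheodory measurable for the Lebesgue outer measure. *)
Definition Rn (R : realType) (n : nat) :=
  caratheodory_type ((borel_lebesgue R n)^*)%mu.

Section Rn.
Context (R : realType) (n : nat).

HB.instance Definition _ := Measurable.copy (Rn R n)
  (caratheodory_type ((borel_lebesgue R n)^*)%mu).

Definition lebesgue_n : set (Rn R n) -> \bar R :=
  @completed_measure_extension _ (n.-tuple (measurableTypeR R)) R
    (borel_lebesgue R n).

HB.instance Definition _ := Measure.on lebesgue_n.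

Let lebesgue_n_sigma_finite : sigma_finite setT lebesgue_n.
Proof.
apply: completed_measure_extension_sigma_finite.
exact: (sigma_finiteT (borel_lebesgue R n)).
Qed.

HB.instance Definition _ := Measure_isSigmaFinite.Build _ _ _ lebesgue_n
  lebesgue_n_sigma_finite.

End Rn.

Section euclidean.
Context {R : realType} {n : nat}.
Implicit Types (x y : Rn R n) (A : set (Rn R n)).

Definition dist_n x y : R :=
  Num.sqrt (\sum_(i < n) (tnth x i - tnth y i) ^+ 2).

Definition interior_n A : set (Rn R n) :=
  [set x | exists2 r : R, 0 < r & [set y | dist_n x y < r] `<=` A].

End euclidean.

(* A cube is the product of n intervals with endpoints corner i and
   corner i + edge; lclosed i and rclosed i tell whether these belong to the
   i-th interval. *)
Record cube (R : realType) (n : nat) := Cube {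
  corner : 'I_n -> R ;
  edge : {posnum R} ;
  lclosed : 'I_n -> bool ;
  rclosed : 'I_n -> bool }.

HB.instance Definition _ (R : realType) (n : nat) := gen_eqMixin (cube R n).
HB.instance Definition _ (R : realType) (n : nat) := gen_choiceMixin (cube R n).

Section cubes.
Context {R : realType} {n : nat}.
Implicit Types Q : cube R n.

Definition cube_itv Q (i : 'I_n) : interval R :=
  Interval (BSide (lclosed Q i) (corner Q i))
           (BSide (~~ rclosed Q i) (corner Q i + (edge Q)%:num)).

Definition cube_set Q : set (Rn R n) :=
  [set x | forall i, tnth x i \in cube_itv Q i].

(* Each edge is cut at its midpoint, which is given to the upper half; s tells
   on which axes the upper half is taken. *)
Definition half_cube Q (s : {ffun 'I_n -> bool}) : cube R n := {|
  corner := fun i => corner Q i + (s i)%:R * ((edge Q)%:num / 2) ;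
  edge := ((edge Q)%:num / 2)%:pos ;
  lclosed := fun i => s i || lclosed Q i ;
  rclosed := fun i => s i && rclosed Q i |}.

Fixpoint dyadic (k : nat) Q : seq (cube R n) :=
  match k with
  | 0 => [:: Q]
  | k'.+1 => flatten [seq [seq half_cube J s | s : {ffun 'I_n -> bool}]
                     | J <- dyadic k' Q]
  end.

(* A collection is a set of cubes, since cubes with disjoint interiors are
   distinct. *)
Definition cube_family (l : R) : set (set (cube R n)) :=
  [set F | (forall Q, F Q -> (edge Q)%:num = l) /\
           trivIset F (fun Q => interior_n (cube_set Q))].

End cubes.
Coercion cube_set : cube >-> set.

Section JNQ.
Local Open Scope ereal_scope.
Context {R : realType} {n : nat}.
Local Notation mu := (@lebesgue_n R n).
Implicit Types (p q alpha : R) (f : Rn R n -> \bar R) (Q J : cube R n).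

Definition ae_finite_measurable f :=
  measurable_fun setT f /\ {ae mu, forall x, f x \is a fin_num}.

Definition JNQ_norm p q alpha f : \bar R :=
  ereal_sup [set (\esum_(Q in F)
      mu Q * (mu Q `^ (q * alpha / n%:R - 1)
              * \int[mu]_(x in Q) \int[mu]_(y in Q)
                  (`|f x - f y| `^ q / (dist_n x y `^ (n%:R + q * alpha))%:E))
             `^ (p / q)) `^ p^-1
    | F in [set F | exists2 l : R, (0 < l)%R & cube_family l F]].

Definition JNQ p q alpha : set (Rn R n -> \bar R) :=
  [set f | ae_finite_measurable f /\ JNQ_norm p q alpha f < +oo].

Definition mean f J : \bar R := (mu J)^-1 * \int[mu]_(x in J) f x.

Definition mean_osc q f J : \bar R :=
  if `[< mu.-integrable setT (f \_ J) >]
  then (mu J)^-1 * \int[mu]_(x in J) `|f x - mean f J| `^ q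
  else +oo.

Definition Psi q alpha f Q : \bar R :=
  (\sum_(0 <= k <oo) (2 `^ ((q * alpha - n%:R) * k%:R))%:E
                     * \sum_(J <- dyadic k Q) mean_osc q f J) `^ q^-1.

Definition tJNQ_norm p q alpha f : \bar R :=
  ereal_sup [set (\esum_(Q in F) mu Q * Psi q alpha f Q `^ p) `^ p^-1
    | F in [set F | exists2 l : R, (0 < l)%R & cube_family l F]].

End JNQ.

(* Main.v *)
Require Import Defs.
From mathcomp Require Import all_boot all_order all_algebra.
From mathcomp Require Import all_classical all_reals all_analysis.
From mathcomp Require Import measurable_realfun.
From mathcomp Require Import ring lra zify.
Set Implicit Arguments.
Unset Strict Implicit.
Unset Printing Implicit Defensive.
Import Order.TTheory GRing.Theory Num.Theory.
Import numFieldNormedType.Exports.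
Local Open Scope classical_set_scope.
Local Open Scope ring_scope.

(** Put [s := n + q * alpha] and [F (x, y) := |f x - f y| ^ q].  For a cube [Q]
    of edge [l] the first norm is built from the local quantity
    [l ^ (s - 2 n)] times the double integral over [Q] of [F / |x - y| ^ s]
    ([frac_energy]), the second one from the [q]-th power of Psi ([Psi_pow]).
    The two norms apply the same operation to these quantities
    ([family_norm]), so it suffices to compare them on cubes.

    The mean oscillation of [f] over a cube [I] is comparable to
    [|I| ^ (- 2)] times the double integral of [F] over [I]
    ([mean_osc_le_square_osc], [square_osc_le_mean_osc]).  Hence [Psi_pow Q] is
    comparable to [l ^ (- 2 n)] times the double integral of [F] against the
    kernel that adds [2 ^ (s k)] for each level [k] at which the two points lie
    in the same dyadic subcube of [Q].

    Psi is controlled by the fractional energy of the same cube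
    ([Psi_pow_le_frac_energy]).  If [s > 0], two points share a subcube of
    level [k] only if [2 ^ k <= n l / |x - y|], so the kernel is a geometric sum
    bounded by a multiple of [(l / |x - y|) ^ s].  If [s <= 0], the weight
    [|x - y| ^ (- s)] may vanish on the diagonal and the kernel may be infinite
    there; instead, [f x] and [f y] are compared through the points of [Q] far
    from both [x] and [y].  Summed over the subcubes of level [k] this gains
    [2 ^ (- k n)], and [2 ^ (s k) 2 ^ (- k n) = 2 ^ (q alpha k)] is summable
    because [q alpha = s - n < 0].

    Conversely, the fractional energy of [Q] is controlled by Psi on [Q] and on
    finitely many translates of [Q] by vectors with coordinates in
    [{0, l, - l / 3, 2 l / 3}] ([frac_energy_le_Psi_pow]).  This is the
    one-third trick: two dyadic grids that differ by a third of [l] have no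
    close boundaries, so two points at distance about [2 ^ (- k) l] share a
    subcube of level [k] of one of the translates.

    Finally, translating all the cubes of a family by one of these vectors
    gives a family of the same kind, so the sum over neighbours costs only a
    constant ([family_norm_le]).

    With the convention of extended real subtraction, [F] is infinite as soon
    as one of the two values of [f] is.  For this reason the pointwise
    inequalities below hold everywhere and not only almost everywhere. *)

(** * Lebesgue measure of cubes *)

Lemma measurable_box (R : realType) (n : nat) (J : 'I_n -> interval R) :
  measurable ([set x | forall i, tnth x i \in J i]
    : set (n.-tuple (measurableTypeR R))).
Proof.
rewrite (_ : [set x | _] = \bigcap_(i in [set: 'I_n])
    ((fun x : n.-tuple (measurableTypeR R) => tnth x i) @^-1` [set` J i])).
  apply: fin_bigcap_measurable => // i _; rewrite -[X in measurable X]setTI.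
  exact: (@measurable_tnth _ (measurableTypeR R) n i).
by apply/seteqP; split=> x /= Jx i => [_|]; exact: Jx.
Qed.

Lemma borel_lebesgue_box (R : realType) (n : nat) (J : 'I_n -> interval R) :
  borel_lebesgue R n [set x | forall i, tnth x i \in J i] =
  (\prod_(i < n) lebesgue_measure [set` J i])%E.
Proof.
elim: n J => [|n IH] J.
  by rewrite big_ord0 /= diracE mem_set//=; case.
rewrite big_ord_recl -IH /= /lebesgue_cons /pushforward.
rewrite (_ : _ @^-1` _ = [set` J ord0] `*`
    [set x | forall i, tnth x i \in J (lift ord0 i)]).
  by apply: product_measure1E => //; exact: measurable_box.
apply/seteqP; split=> -[x t] /=.
  move=> H; split=> [|i]; first exact: (H ord0).
  by move: (H (lift ord0 i)); rewrite tnthS.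
move=> [H0 H] i; case: (unliftP ord0 i) => [j ->|->]; last exact: H0.
by rewrite tnthS.
Qed.

Section Rn_measure.
Context {R : realType} {n : nat}.
Local Notation E := (Rn R n : measurableType _).
Local Notation mu := (@lebesgue_n R n).
Implicit Types (x y : Rn R n) (Q : cube R n).

Lemma Borel_measurable_Rn (A : set (n.-tuple (measurableTypeR R))) :
  measurable A -> measurable (A : set (Rn R n)).
Proof.
move=> mA; apply: (@sub_caratheodory _ _ _ (borel_lebesgue R n)).
exact: sub_sigma_algebra.
Qed.

Lemma measurable_coord (i : 'I_n) :
  measurable_fun setT (fun x : Rn R n => (tnth x i : R)).
Proof.
move=> _ B mB; apply: Borel_measurable_Rn.
exact: (@measurable_tnth _ (measurableTypeR R) n i).
Qed.

Lemma measurable_dist_n :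
  measurable_fun setT (fun z : E * E => dist_n z.1 z.2).
Proof.
apply: (measurableT_comp (continuous_measurable_fun (@sqrt_continuous R))).
apply: measurable_sum => i; apply: measurable_funX.
by apply: measurable_funB;
  [exact: (measurableT_comp (measurable_coord i) measurable_fst)
  |exact: (measurableT_comp (measurable_coord i) measurable_snd)].
Qed.

Lemma measurable_cube Q : measurable (cube_set Q).
Proof. by apply: Borel_measurable_Rn; exact: measurable_box. Qed.

Lemma lebesgue_cube Q : mu Q = ((edge Q)%:num ^+ n)%:E.
Proof.
have -> : mu Q = borel_lebesgue R n (cube_set Q).
  by apply: measurable_mu_extE; exact: measurable_box.
rewrite borel_lebesgue_box -[X in _ ^+ X]card_ord -prodr_const -prodEFin.
apply: eq_bigr => i _; rewrite lebesgue_measure_itv/= lte_fin ltrDl.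
by rewrite gt0 -EFinD addrAC subrr add0r.
Qed.

End Rn_measure.

(** * Distances and dyadic subcubes *)

Section geometry.
Context {R : realType} {n : nat}.
Implicit Types (x y : Rn R n) (Q J : cube R n).

Lemma dist_n_ge0 x y : 0 <= dist_n x y.
Proof. exact: sqrtr_ge0. Qed.

Lemma coord_le_dist x y i : `|tnth x i - tnth y i| <= dist_n x y.
Proof.
rewrite -sqrtr_sqr ler_wsqrtr// (bigD1 i)//= lerDl sumr_ge0// => j _.
exact: sqr_ge0.
Qed.

Lemma dist_n_eq0 x y : dist_n x y = 0 -> x = y.
Proof.
move=> xy; apply: eq_from_tnth => i; apply/eqP; rewrite -subr_eq0 -normr_le0.
by rewrite -xy coord_le_dist.
Qed.

Lemma dist_le_coord x y (d : R) : 0 <= d ->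
  (forall i, `|tnth x i - tnth y i| <= d) -> dist_n x y <= n%:R * d.
Proof.
move=> d0 xyd; have nd0 : 0 <= n%:R * d by rewrite mulr_ge0.
rewrite -[leRHS](ger0_norm nd0) -sqrtr_sqr ler_wsqrtr//.
apply: (@le_trans _ _ (\sum_(i < n) d ^+ 2)).
  apply: ler_sum => i _; rewrite -real_normK ?num_real// lerXn2r ?nnegrE//.
rewrite sumr_const card_ord -[leLHS]mulr_natl exprMn ler_wpM2r ?sqr_ge0//.
by rewrite -natrX ler_nat; case: (n) => // m; rewrite expnS expn1 leq_pmulr.
Qed.

Lemma cube_coordP Q x i : x \in cube_set Q ->
  corner Q i <= tnth x i <= corner Q i + (edge Q)%:num.
Proof.
rewrite inE => /(_ i); rewrite /cube_itv itv_boundlr => /andP[].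
by case: lclosed; case: rclosed => /=; rewrite !bnd_simp => *; apply/andP; split=> //; exact: ltW.
Qed.

Lemma cube_coord_dist Q x y i : x \in cube_set Q -> y \in cube_set Q ->
  `|tnth x i - tnth y i| <= (edge Q)%:num.
Proof.
move=> /(cube_coordP i)/andP[x1 x2] /(cube_coordP i)/andP[y1 y2].
by rewrite ler_distl; apply/andP; split; lra.
Qed.

(** The half that contains a point of [Q] is read off by comparing the
    coordinates of the point with those of the centre of [Q]. *)
Lemma half_cube_in Q (s : {ffun 'I_n -> bool}) x :
  (x \in cube_set (half_cube Q s)) =
  (x \in cube_set Q) &&
  (s == [ffun i => corner Q i + (edge Q)%:num / 2 <= tnth x i]).
Proof.
have e0 : 0 < (edge Q)%:num by [].
apply/idP/andP.
  move=> xs; split.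
    rewrite inE => i; move: xs; rewrite inE => /(_ i).
    rewrite /cube_itv !itv_boundlr/=; case: (s i) => /=; rewrite ?mul0r ?mul1r ?addr0.
      rewrite -addrA -splitr => /andP[h1 ->]; rewrite andbT.
      case: (lclosed Q i) h1; rewrite !bnd_simp => h; lra.
    move=> /andP[-> h1] /=; case: (rclosed Q i) h1; rewrite !bnd_simp => h; lra.
  apply/eqP/ffunP => i; rewrite ffunE; move: xs; rewrite inE => /(_ i).
  rewrite /cube_itv !itv_boundlr/=; case: (s i) => /=; rewrite ?mul0r ?mul1r ?addr0.
    by move=> /andP[]; rewrite !bnd_simp => -> _.
  move=> /andP[_]; rewrite !bnd_simp => h; apply/esym/negbTE; rewrite -ltNge; lra.
move=> [xQ /eqP ->]; rewrite inE => i; move: xQ; rewrite inE => /(_ i).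
rewrite /cube_itv !itv_boundlr/= !ffunE; case: (leP (_ + _ / 2) (tnth x i)) => h /=;
  rewrite ?mul0r ?mul1r ?addr0.
  by rewrite -addrA -splitr => /andP[_ ->]; rewrite andbT bnd_simp.
by move=> /andP[-> _] /=; rewrite bnd_simp.
Qed.

Lemma sum_indic_dyadic k Q x :
  \sum_(J <- dyadic k Q) \1_(cube_set J) x = \1_(cube_set Q) x :> R.
Proof.
elim: k => [|k IH]; first by rewrite big_seq1.
rewrite /= big_flatten big_map -IH; apply: eq_bigr => J _.
rewrite big_map big_enum/=.
rewrite (eq_bigr (fun s : {ffun 'I_n -> bool} => \1_(cube_set J) x *
    (s == [ffun i => corner J i + (edge J)%:num / 2 <= tnth x i])%:R :> R)).
  rewrite -mulr_sumr (bigD1 [ffun i => corner J i + (edge J)%:num / 2 <= tnth x i])//=.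
  by rewrite eqxx big1 ?addr0 ?mulr1// => s /negbTE ->.
by move=> s _; rewrite !indicE half_cube_in; case: (x \in _); rewrite ?mul0r ?mul1r.
Qed.

Lemma dyadic_ind k Q (P : nat -> cube R n -> Prop) :
  P 0%N Q ->
  (forall j J s, P j J -> P j.+1 (half_cube J s)) ->
  forall J, J \in dyadic k Q -> P k J.
Proof.
move=> P0 PS; elim: k => [J|k IH J]; first by rewrite inE => /eqP ->.
by move=> /flatten_mapP[J' /IH PJ'] /mapP[s _ ->]; exact: PS.
Qed.

Lemma edge_dyadic k Q J : J \in dyadic k Q ->
  (edge J)%:num = (edge Q)%:num / 2 ^+ k.
Proof.
move: J; apply: (@dyadic_ind k Q (fun k J => (edge J)%:num = (edge Q)%:num / 2 ^+ k)).
  by rewrite expr0 divr1.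
by move=> j J s /= ->; rewrite exprS invfM; lra.
Qed.

Lemma dyadic_subset k Q J : J \in dyadic k Q -> cube_set J `<=` cube_set Q.
Proof.
move: J; apply: (@dyadic_ind k Q (fun _ J => cube_set J `<=` cube_set Q)) => //.
move=> j J s JQ x /mem_set; rewrite half_cube_in => /andP[xJ _].
by apply: JQ; rewrite inE in xJ.
Qed.

End geometry.

(** * The one-third trick *)

Section one_third.
Context {R : realType}.

(** The offsets [0], [1], [- 1 / 3] and [2 / 3]: the first component selects the
    grid, the second one of two consecutive intervals of that grid. *)
Definition third (b : bool * bool) : R := b.2%:R - b.1%:R / 3.

(** Otherwise both an integer and a point of the integer grid translated by
    [- K / 3] lie between [X] and [Y].  Their difference is a multiple of
    [1 / 3], nonzero since 3 does not divide [K], and yet less than [1 / 3]. *)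
Lemma one_third_floor (X Y : R) (K : nat) :
  `|X - Y| < 3^-1 -> (forall m, K != 3 * m :> nat)%N ->
  exists t : bool, Num.floor (X + t%:R * (K%:R / 3)) =
                   Num.floor (Y + t%:R * (K%:R / 3)).
Proof.
move=> XY K3.
wlog XleY : X Y XY / X <= Y.
  move=> H; case: (leP X Y) => [|/ltW] h; first exact: H.
  by have [|t Ht] := H Y X _ h; [rewrite distrC|exists t].
have [XY0|XY0] := eqVneq (Num.floor X) (Num.floor Y).
  by exists false; rewrite !mul0r !addr0.
exists true; rewrite !mul1r; apply/eqP; apply: contraT => XY1.
have crossing (u v : R) : u <= v -> Num.floor u != Num.floor v ->
    u < (Num.floor v)%:~R <= v.
  move=> uv fuv; rewrite floor_le_tmp andbT -floor_lt_int lt_neqAle fuv/=.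
  exact: le_floor.
have /andP[m1 m2] := crossing _ _ XleY XY0.
have /andP[m3 m4] : X + K%:R / 3 < (Num.floor (Y + K%:R / 3))%:~R <= Y + K%:R / 3.
  by apply: crossing => //; rewrite lerD2r.
set a := Num.floor Y in m1 m2 *; set b := Num.floor (Y + _) in m3 m4 *.
have /ltr_normlP[XY1' XY2] := XY.
have [ab ba] : 3 * a + K%:Z < 3 * b + 1 /\ 3 * b < 3 * a + K%:Z + 1.
  by split; rewrite -(ltr_int R) !(intrD, intrM) !mulr1z -pmulrn; lra.
by have := K3 `|b - a|%N; lia.
Qed.

Lemma pow2_neq_mul3 k m : (2 ^ k != 3 * m)%N.
Proof.
apply/eqP => km; have : (3 %| 2 ^ k)%N by rewrite km dvdn_mulr.
by rewrite Euclid_dvdX// => /andP[].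
Qed.

(** In the translated grid of mesh [h], the interval of length [K * h] that
    contains the point is the first or the second one, according to whether its
    integer position [m] has reached [K]. *)
Lemma shifted_grid_floor (c h Z v : R) k :
  let K : R := 2 ^+ k in
  let m := Num.floor (Z + v) in
  let e : bool := K <= m%:~R in
  let c' := c + (K * e%:R - v) * h in
  0 < h -> 0 <= Z -> Z <= K -> 0 <= v -> v <= K / 3 ->
  c' <= c + Z * h < c' + K * h /\
  Num.floor ((c + Z * h - c') / h) = m - e%:Z * 2 ^+ k.
Proof.
move=> K m e c' h0 Z0 ZK v0 vK; have K0 : 0 < K by rewrite exprn_gt0.
have /andP[mZ Zm1] := floor_itv (Z + v); rewrite -/m in mZ Zm1.
have Z'E : (c + Z * h - c') / h = Z + v - K * e%:R.
  by rewrite /c'; field; rewrite gt_eqF.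
have [Z'0 Z'K] : 0 <= Z + v - K * e%:R /\ Z + v - K * e%:R < K.
  rewrite /e; case: (leP K m%:~R) => Km /=; rewrite ?mulr1 ?mulr0 ?subr0.
    by clear -mZ Km ZK vK K0; split; lra.
  split; first exact: addr_ge0.
  (* an integer below the integer [K] is at most [K - 1] *)
  apply: (lt_le_trans Zm1); move: Km.
  by rewrite /K -natrX pmulrn ltr_int ler_int lezD1.
split.
  have -> : c + Z * h = c' + (Z + v - K * e%:R) * h.
    by rewrite -Z'E divfK ?gt_eqF//; ring.
  by rewrite lerDl mulr_ge0 ?(ltW h0)//= ltrD2l ltr_pM2r.
have eK : (m - e%:Z * 2 ^+ k)%:~R = m%:~R - K * e%:R :> R.
  by rewrite intrB intrM rmorphXn/= mulrC -pmulrn.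
rewrite Z'E; apply/eqP; rewrite floor_eq [X in _ < X]intrD eK mulr1z.
by rewrite lerD2r mZ [ltRHS]addrAC ltrD2r; move: Zm1; rewrite intrD mulr1z.
Qed.

(** One of the two grids does not separate [x] and [y]; the offset then only
    has to select the interval of length [l] that contains both. *)
Lemma one_third_offset (c l x y : R) k : 0 < l ->
  c <= x <= c + l -> c <= y <= c + l -> `|x - y| < l / 2 ^+ k / 3 ->
  exists b : bool * bool, let c' := c + l * third b in
    [/\ c' <= x < c' + l, c' <= y < c' + l &
        Num.floor ((x - c') / (l / 2 ^+ k)) =
        Num.floor ((y - c') / (l / 2 ^+ k))].
Proof.
move=> l0 /andP[cx xl] /andP[cy yl] xy.
set h := l / 2 ^+ k; have h0 : 0 < h by rewrite divr_gt0// exprn_gt0.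
pose X := (x - c) / h; pose Y := (y - c) / h; pose K : R := 2 ^+ k.
have lK : l = K * h by rewrite mulrC divfK// expf_neq0.
have xX : x = c + X * h by rewrite divfK ?gt_eqF// addrC subrK.
have yY : y = c + Y * h by rewrite divfK ?gt_eqF// addrC subrK.
have K0 : 0 < K by rewrite exprn_gt0.
have [X0 XK] : 0 <= X /\ X <= K.
  by split; [rewrite divr_ge0 ?subr_ge0// ltW|rewrite ler_pdivrMr// -lK; lra].
have [Y0 YK] : 0 <= Y /\ Y <= K.
  by split; [rewrite divr_ge0 ?subr_ge0// ltW|rewrite ler_pdivrMr// -lK; lra].
have XY : `|X - Y| < 3^-1.
  rewrite -mulrBl opprB addrA subrK normrM normfV (gtr0_norm h0).
  by rewrite ltr_pdivrMr// mulrC.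
have [t] := @one_third_floor X Y (2 ^ k) XY (pow2_neq_mul3 k).
rewrite natrX -/K => ft.
set m := Num.floor (X + _) in ft.
pose b := (t, K <= m%:~R); exists b => c'.
have c'E : c' = c + (K * (K <= m%:~R)%R%:R - t%:R * (K / 3)) * h.
  by rewrite /c' /third/= lK; ring.
have [v0 vK] : 0 <= t%:R * (K / 3) /\ t%:R * (K / 3) <= K / 3.
  by case: (t); rewrite ?mul1r ?mul0r lexx divr_ge0// ltW.
have [] := shifted_grid_floor c h0 X0 XK v0 vK.
rewrite -/K -/m -c'E -lK -xX => hx1 hx2.
have [] := shifted_grid_floor c h0 Y0 YK v0 vK.
rewrite -/K -ft -c'E -lK -yY => hy1 hy2.
by rewrite hx1 hy1 hx2 hy2.
Qed.

End one_third.

Section shifted_cubes.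
Context {R : realType} {n : nat}.
Implicit Types (x y : Rn R n) (Q J : cube R n) (b : {ffun 'I_n -> bool * bool}).

Definition half_open Q := forall i, lclosed Q i && ~~ rclosed Q i.

Lemma half_open_in Q x : half_open Q -> x \in cube_set Q <->
  forall i, corner Q i <= tnth x i < corner Q i + (edge Q)%:num.
Proof.
move=> hQ; rewrite inE; split=> xQ i; move: (xQ i) (hQ i);
  rewrite /cube_itv itv_boundlr; case: lclosed; case: rclosed => //=;
  by rewrite !bnd_simp.
Qed.

Lemma dyadic_half_open k Q J : half_open Q -> J \in dyadic k Q ->
  half_open J /\
  forall i, exists m : nat, corner J i = corner Q i + (edge Q)%:num / 2 ^+ k * m%:R.
Proof.
move=> hQ JQ.
suff [] : half_open J /\ (edge J)%:num = (edge Q)%:num / 2 ^+ k /\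
  forall i, exists m : nat, corner J i = corner Q i + (edge Q)%:num / 2 ^+ k * m%:R.
  by move=> ? [].
move: J JQ; apply: (@dyadic_ind R n k Q (fun k J =>
  half_open J /\ (edge J)%:num = (edge Q)%:num / 2 ^+ k /\
  forall i, exists m : nat, corner J i = corner Q i + (edge Q)%:num / 2 ^+ k * m%:R)).
  split => //; split => [|i]; first by rewrite expr0 divr1.
  by exists 0%N; rewrite mulr0 addr0.
move=> j J s [hJ [eJ cJ]]; split => [i|].
  by case/andP: (hJ i) => lJ rJ /=; case: (s i); rewrite /= ?lJ ?rJ.
split => [|i] /=; first by rewrite eJ exprS invfM; lra.
have [m ->] := cJ i; exists (2 * m + s i)%N.
by rewrite eJ natrD natrM exprS; field; rewrite expf_neq0.
Qed.

Lemma dyadic_same_floor k Q x y : half_open Q ->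
  x \in cube_set Q ->
  (forall i, Num.floor ((tnth x i - corner Q i) / ((edge Q)%:num / 2 ^+ k)) =
             Num.floor ((tnth y i - corner Q i) / ((edge Q)%:num / 2 ^+ k))) ->
  exists2 J, J \in dyadic k Q & x \in cube_set J /\ y \in cube_set J.
Proof.
move=> hQ xQ xy.
have [J JQ xJ] : exists2 J, J \in dyadic k Q & x \in cube_set J.
  apply: contrapT => noJ.
  have := sum_indic_dyadic k Q x; rewrite indicE xQ big_seq big1.
    by move/esym/eqP; rewrite oner_eq0.
  move=> J JQ; rewrite indicE; case: (boolP (x \in _)) => // xJ.
  by exfalso; apply: noJ; exists J.
exists J => //; split => //.
have [hJ cJ] := dyadic_half_open hQ JQ.
apply/(half_open_in y hJ) => i.
have /(half_open_in x hJ)/(_ i) := xJ.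
have [m ->] := cJ i; rewrite (edge_dyadic JQ).
have h0 : 0 < (edge Q)%:num / 2 ^+ k by rewrite divr_gt0// exprn_gt0.
move: (_ / _) h0 (xy i) => h h0 xyi.
have floorm (v : R) : (corner Q i + h * m%:R <= v < corner Q i + h * m%:R + h) =
    (Num.floor ((v - corner Q i) / h) == m%:Z).
  rewrite floor_eq intrD mulr1z -pmulrn ler_pdivlMr// ltr_pdivrMr// lerBrDl ltrBlDl.
  by rewrite mulrDl mul1r addrA ![h * _]mulrC.
by rewrite !floorm xyi.
Qed.

(** Half-open sides make the translated grids cover every pair of points of
    [Q], including those on its boundary. *)
Definition shifted_cube Q b : cube R n := {|
  corner := fun i => corner Q i + (edge Q)%:num * third (b i) ;
  edge := edge Q ;
  lclosed := fun=> true ;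
  rclosed := fun=> false |}.

Lemma one_third_cube k Q x y : x \in cube_set Q -> y \in cube_set Q ->
  (forall i, `|tnth x i - tnth y i| < (edge Q)%:num / 2 ^+ k / 3) ->
  exists b, exists2 J, J \in dyadic k (shifted_cube Q b) &
    x \in cube_set J /\ y \in cube_set J.
Proof.
move=> xQ yQ xy.
have [b bP] := choice (fun i => one_third_offset (gt0 (edge Q))
  (cube_coordP i xQ) (cube_coordP i yQ) (xy i)).
exists (finfun b); apply: dyadic_same_floor => //.
  by apply/half_open_in => // i; have [] := bP i; rewrite /= ffunE.
by move=> i; have [_ _] := bP i; rewrite /= ffunE.
Qed.

End shifted_cubes.

Section overlap.
Context {R : realType} {n : nat}.
Local Notation E := (Rn R n : measurableType _).
Implicit Types (z : E * E) (Q J : cube R n) (k : nat).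

(** It takes the values 0 and 1 only, since the subcubes of a given level are
    disjoint. *)
Definition overlap k Q z : R :=
  \sum_(J <- dyadic k Q) \1_(cube_set J `*` cube_set J) z.

Lemma overlap_ge0 k Q z : 0 <= overlap k Q z.
Proof. exact: sumr_ge0. Qed.

Lemma overlap_le k Q z : overlap k Q z <= \1_(cube_set Q `*` cube_set Q) z.
Proof.
case: z => x y; have [yQ|yQ] := boolP (y \in cube_set Q).
  apply: (@le_trans _ _ (\1_(cube_set Q) x)).
    rewrite -(sum_indic_dyadic k); apply: ler_sum => J _; rewrite !indicE.
    by rewrite in_setX; case: (x \in _) => //=; rewrite lern1 leq_b1.
  by rewrite !indicE in_setX yQ andbT.
rewrite /overlap big_seq big1 ?indicE// => J JQ.
rewrite indicE in_setX [X in _ && X](_ : _ = false) ?andbF//=.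
apply/negbTE; apply: contra yQ => /set_mem yJ; apply/mem_set.
exact: (dyadic_subset JQ).
Qed.

Lemma overlap_ge1 k Q J x y : J \in dyadic k Q ->
  x \in cube_set J -> y \in cube_set J -> 1 <= overlap k Q (x, y).
Proof.
move=> JQ xJ yJ; rewrite /overlap (big_rem J)//= indicE in_setX xJ yJ/=.
by rewrite lerDl; apply: sumr_ge0.
Qed.

Lemma overlap_far k Q z :
  n%:R * ((edge Q)%:num / 2 ^+ k) < dist_n z.1 z.2 -> overlap k Q z = 0.
Proof.
case: z => x y /= xy; rewrite /overlap big_seq big1// => J JQ.
rewrite indicE in_setX; case: (boolP (_ && _)) => //= /andP[xJ yJ].
move: xy; rewrite ltNge => /negP[]; apply: dist_le_coord.
  by rewrite divr_ge0// exprn_ge0.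
by move=> i; rewrite -(edge_dyadic JQ); exact: cube_coord_dist.
Qed.

Lemma measurable_overlap k Q : measurable_fun setT (overlap k Q).
Proof.
apply: measurable_sum => J; apply: measurable_indic.
by apply: measurableX; exact: measurable_cube.
Qed.

End overlap.

(** * Mean oscillation and double integrals *)

Section differences.
Local Open Scope ereal_scope.
Context {R : realType} (q : R) (q1 : (1 <= q)%R).

Let q0 : (0 < q)%R. Proof. exact: lt_le_trans q1. Qed.

Lemma powR_add_le (a b : R) : (0 <= a -> 0 <= b ->
  (a + b) `^ q <= 2 `^ q * (a `^ q + b `^ q))%R.
Proof.
move=> a0 b0.
wlog ab : a b a0 b0 / (a <= b)%R.
  move=> H; case: (leP a b) => [|/ltW] ab; first exact: H.
  by rewrite addrC [X in (_ * X)%R]addrC; exact: H.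
apply: (@le_trans _ _ ((2 * b) `^ q)%R).
  by apply: ge0_ler_powR; rewrite ?nnegrE ?(ltW q0)//; lra.
rewrite powRM// ler_wpM2l ?powR_ge0// lerDr powR_ge0//.
Qed.

(** Both sides are compared with the [q]-th power of the larger of [t] and
    [c]. *)
Lemma mul_powRB1_le (t c : R) : (0 <= t -> 0 < c ->
  t * c `^ (q - 1) <= c `^ q + t `^ q)%R.
Proof.
move=> t0 c0; have [tc|/ltW ct] := leP t c.
  apply: (@le_trans _ _ (c `^ q)%R); last by rewrite lerDl powR_ge0.
  by rewrite -[leRHS]mulr_powRB1 ?(ltW c0)// ler_wpM2r// powR_ge0.
apply: (@le_trans _ _ (t `^ q)%R); last by rewrite lerDr powR_ge0.
rewrite -[leRHS]mulr_powRB1 ?(ltW c0)// ler_wpM2l//.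
by apply: ge0_ler_powR; rewrite ?nnegrE ?(ltW c0)// subr_ge0.
Qed.

Lemma abse_subC (a b : \bar R) : `|a - b| = `|b - a|.
Proof. by move: a b => [a| |] [b| |] //=; rewrite distrC. Qed.

(** At infinite values the inequality survives because [`|a - b|] is infinite as
    soon as one of [a] and [b] is. *)
Lemma abse_sub_poweR_le (a b c : \bar R) :
  `|a - b| `^ q <= (2 `^ q)%:E * (`|a - c| `^ q + `|c - b| `^ q).
Proof.
have q_neq0 : q != 0%R by rewrite gt_eqF.
have two_pos : 0 < (2 `^ q)%:E :> \bar R by rewrite lte_fin powR_gt0.
have infl x : +oo + `|x| `^ q = +oo.
  by rewrite addye// gt_eqF// (lt_le_trans _ (poweR_ge0 _ _)) ?ltNyr.
have infr x : `|x| `^ q + +oo = +oo by rewrite addeC infl.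
have inf1 x y z : `|x - y| = +oo ->
    `|z| `^ q <= (2 `^ q)%:E * (`|x - y| `^ q + `|y - b| `^ q).
  by move=> ->; rewrite (poweRyr q_neq0) infl gt0_muley// leey.
have inf2 x y z : `|y - b| = +oo ->
    `|z| `^ q <= (2 `^ q)%:E * (`|x - y| `^ q + `|y - b| `^ q).
  by move=> ->; rewrite (poweRyr q_neq0) infr gt0_muley// leey.
case: c => [c| |]; last 2 first.
- by apply: inf1; case: (a).
- by apply: inf1; case: (a).
case: a => [a| |]; [|exact: inf1..].
case: b inf1 inf2 => [b| |] inf1 inf2; [|exact: inf2..].
rewrite /= lee_fin.
apply: le_trans (powR_add_le (normr_ge0 _) (normr_ge0 _)).
apply: ge0_ler_powR; rewrite ?nnegrE ?(ltW q0)//.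
by rewrite -[(a - b)%R](subrKA c) ler_normD.
Qed.

End differences.

Section square_integral.
Local Open Scope ereal_scope.
Context d (T : measurableType d) (R : realType).
Variable mu : {sigma_finite_measure set T -> \bar R}.

Lemma iterated_integralE (A B : set T) (H : T * T -> \bar R) :
  measurable A -> measurable B -> measurable_fun setT H -> (forall z, 0 <= H z) ->
  \int[mu]_(x in A) \int[mu]_(y in B) H (x, y) =
  \int[mu \x mu]_(z in A `*` B) H z.
Proof.
move=> mA mB mH H0; rewrite [RHS]integral_mkcond fubini_tonelli1; last first.
- exact: erestrict_ge0.
- apply/(measurable_restrictT _ _).1; first exact: measurableX.
  exact: measurable_funTS.
rewrite integral_mkcond; apply: eq_integral => x _; rewrite /fubini_F patchE.
case: ifPn => xA.
  rewrite [LHS]integral_mkcond; apply: eq_integral => y _; rewrite !patchE.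
  by rewrite in_setX xA.
rewrite -[LHS]/(0 : \bar R) -[LHS](integral0 mu setT); apply: eq_integral => y _; rewrite patchE.
by rewrite in_setX (negbTE xA).
Qed.

Lemma measurable_integral1 (B : set T) (H : T * T -> \bar R) :
  measurable B -> measurable_fun setT H -> (forall z, 0 <= H z) ->
  measurable_fun setT (fun x => \int[mu]_(y in B) H (x, y)).
Proof.
move=> mB mH H0.
rewrite (_ : (fun x => _) = fubini_F mu (H \_ (setT `*` B))).
  apply: measurable_fun_fubini_tonelli_F; last exact: erestrict_ge0.
  apply/(measurable_restrictT _ _).1; first exact: measurableX.
  exact: measurable_funTS.
apply/funext => x; rewrite integral_mkcond; apply: eq_integral => y _.
by rewrite !patchE in_setX in_setT.
Qed.

Lemma iterated_integral_add (A : set T) (v : R) (g : T -> \bar R) :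
  measurable A -> mu A = v%:E -> measurable_fun setT g -> (forall x, 0 <= g x) ->
  \int[mu]_(x in A) \int[mu]_(y in A) (g x + g y) =
  (2 * v)%:E * \int[mu]_(x in A) g x.
Proof.
move=> mA muA mg g0; have mgA : measurable_fun A g by exact: measurable_funTS.
have v0 : (0 <= v)%R by rewrite -lee_fin -muA.
have cstE c : \int[mu]_(y in A) c = v%:E * c.
  by have /= -> := integral_cst mu mA c; rewrite muA muleC.
under eq_integral => x _ do rewrite ge0_integralD// cstE.
have ig0 : 0 <= \int[mu]_(x in A) g x by exact: integral_ge0.
rewrite ge0_integralD//; last 2 first.
- by move=> x _; rewrite mule_ge0.
- exact: measurable_funeM.
rewrite ge0_integralZl_EFin// cstE -ge0_muleDl ?lee_fin// -EFinD.
by rewrite -[(v + v)%R]mulr2n mulr_natl.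
Qed.

End square_integral.

Section weighted_integral.
Local Open Scope ereal_scope.
Context d (T : measurableType d) (R : realType) (nu : {measure set T -> \bar R}).
Variable F : T -> \bar R.
Hypotheses (mF : measurable_fun setT F) (F0 : forall z, 0 <= F z).

Lemma sum_integral_indic (I : Type) (r : seq I) (A : I -> set T) :
  (forall i, measurable (A i)) ->
  \sum_(i <- r) \int[nu]_(z in A i) F z =
  \int[nu]_z (F z * (\sum_(i <- r) \1_(A i) z)%:E).
Proof.
move=> mA; under [RHS]eq_integral => z _.
  rewrite -sumEFin ge0_sume_distrr; last by move=> i _; rewrite lee_fin.
  over.
rewrite ge0_integral_sum//; last 2 first.
- move=> i; apply: emeasurable_funM => //; apply/measurable_EFinP.
  exact: measurable_indic.
- by move=> i z _; rewrite mule_ge0// lee_fin.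
by apply: eq_bigr => i _; rewrite integral_mkcond epatch_indic.
Qed.

Variables (w : nat -> R) (o : nat -> T -> R).
Hypotheses (w0 : forall k, (0 <= w k)%R) (o0 : forall k z, (0 <= o k z)%R).
Hypothesis mo : forall k, measurable_fun setT (o k).

Let term0 k z : 0 <= (w k)%:E * (F z * (o k z)%:E).
Proof. by rewrite !mule_ge0// lee_fin. Qed.

Let mFo k : measurable_fun setT (fun z => F z * (o k z)%:E).
Proof. by apply: emeasurable_funM => //; exact/measurable_EFinP. Qed.

Lemma weighted_series_ge0 z :
  0 <= \sum_(0 <= k <oo) (w k)%:E * (F z * (o k z)%:E).
Proof. by apply: nneseries_ge0 => k _ _; exact: term0. Qed.

Lemma measurable_weighted_series : measurable_fun setT
  (fun z => \sum_(0 <= k <oo) (w k)%:E * (F z * (o k z)%:E)).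
Proof.
apply: ge0_emeasurable_sum => [k z _ _|k _]; first exact: term0.
exact: measurable_funeM.
Qed.

Lemma series_integral_weight :
  \sum_(0 <= k <oo) (w k)%:E * \int[nu]_z (F z * (o k z)%:E) =
  \int[nu]_z \sum_(0 <= k <oo) (w k)%:E * (F z * (o k z)%:E).
Proof.
rewrite integral_nneseries//; last by move=> k; exact: measurable_funeM.
apply: eq_eseriesr => k _; rewrite ge0_integralZl_EFin// => z _.
by rewrite mule_ge0// lee_fin.
Qed.

End weighted_integral.

Section oscillation.
Local Open Scope ereal_scope.
Context d (T : measurableType d) (R : realType).
Variable mu : {sigma_finite_measure set T -> \bar R}.
Context (q : R) (q1 : (1 <= q)%R) (f : T -> \bar R).
Hypothesis mf : measurable_fun setT f.

Definition diff_pow (z : T * T) : \bar R := `|f z.1 - f z.2| `^ q.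

Let q0 : (0 < q)%R. Proof. exact: lt_le_trans q1. Qed.
Let qN0 : q != 0%R. Proof. by rewrite gt_eqF. Qed.

Lemma diff_pow_ge0 z : 0 <= diff_pow z.
Proof. exact: poweR_ge0. Qed.

Lemma diff_powC x y : diff_pow (x, y) = diff_pow (y, x).
Proof. by rewrite /diff_pow abse_subC. Qed.

Lemma diff_pow_trans x y z :
  diff_pow (x, y) <= (2 `^ q)%:E * (diff_pow (x, z) + diff_pow (y, z)).
Proof. by rewrite [diff_pow (y, z)]diff_powC; exact: abse_sub_poweR_le. Qed.

Lemma diff_pow_diag x : diff_pow (x, x) = 0 \/ diff_pow (x, x) = +oo.
Proof.
rewrite /diff_pow/=; case: (f x) => [r| |]; last 2 first.
  by right; exact: poweRyr.
  by right; exact: poweRyr.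
by left; rewrite -EFinB subrr abse0 poweR0r.
Qed.

Lemma diff_pow_infinite x y : f x \isn't a fin_num -> diff_pow (x, y) = +oo.
Proof.
move=> fx; rewrite /diff_pow (_ : `|_| = +oo) ?poweRyr//=.
by case: (f x) fx => // _; case: (f y).
Qed.

Lemma measurable_diff_pow : measurable_fun setT diff_pow.
Proof.
apply: (measurableT_comp (measurable_poweR q)).
apply: measurableT_comp => //.
by apply: emeasurable_funB; apply: measurableT_comp.
Qed.

Lemma measurable_diff_powM (g : T * T -> \bar R) :
  measurable_fun setT g -> measurable_fun setT (fun z => diff_pow z * g z).
Proof. by move=> mg; apply: emeasurable_funM => //; exact: measurable_diff_pow. Qed.

Context (A : set T) (v : R) (mA : measurable A) (v0 : (0 < v)%R).
Hypothesis muA : mu A = v%:E.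

Let integral_cstE (c : R) : \int[mu]_(x in A) c%:E = (c * v)%:E.
Proof. by have /= -> := integral_cst mu mA c%:E; rewrite muA EFinM. Qed.

Let integrable_cst (c : R) : mu.-integrable A (fun=> c%:E).
Proof.
apply/integrableP; split; first exact: measurable_cst.
by rewrite [X in X < _](integral_cstE `|c|%R) ltry.
Qed.

Let integral_csty : \int[mu]_(x in A) +oo = +oo.
Proof.
by have /= -> := integral_cst mu mA +oo; rewrite muA gt0_mulye// lte_fin.
Qed.

(** A weak form of Jensen's inequality.  The average [m] of [g] is at most twice
    the average of [g] over the places where [g] exceeds [m / 2], and there [g]
    is at most [g `^ q] times [(m / 2) `^ (1 - q)]. *)
Lemma average_powR_le (g : T -> \bar R) (m : R) :
  measurable_fun A g -> (forall x, 0 <= g x) ->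
  \int[mu]_(x in A) g x = (v * m)%:E ->
  ((m / 2) `^ q * v)%:E <= \int[mu]_(x in A) g x `^ q.
Proof.
move=> mg g0 gm.
have mgq : measurable_fun A (fun x => g x `^ q).
  exact: (measurableT_comp (measurable_poweR q)).
have m0 : (0 <= m)%R.
  by rewrite -(@pmulr_rge0 _ v)// -lee_fin -gm integral_ge0.
have [->|mN0] := eqVneq m 0%R.
  by rewrite mul0r powR0// mul0r integral_ge0// => x _; exact: poweR_ge0.
have m2 : (0 < m / 2)%R by rewrite divr_gt0// lt_neqAle eq_sym mN0.
have c0 := powR_gt0 (q - 1) m2.
have : \int[mu]_(x in A) (((m / 2) `^ (q - 1))%:E * g x) <=
       \int[mu]_(x in A) (((m / 2) `^ q)%:E + g x `^ q).
  apply: ge0_le_integral => //.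
  - by move=> x _; rewrite mule_ge0// lee_fin ltW.
  - exact: measurable_funeM.
  - by apply: emeasurable_funD => //; exact: measurable_cst.
  move=> x _; move: (g x) (g0 x) => [t| |] // t0.
    by rewrite poweR_EFin -EFinM -EFinD lee_fin mulrC mul_powRB1_le.
  by rewrite poweRyr// addey// leey.
rewrite ge0_integralZl_EFin//; last exact: ltW.
rewrite gm ge0_integralD//; last 2 first.
- by move=> x _; rewrite lee_fin powR_ge0.
- by move=> x _; exact: poweR_ge0.
rewrite integral_cstE -!EFinM -leeBlDl// -EFinB; apply: le_trans.
rewrite lee_fin -(@mulr_powRB1 _ (m / 2) q)//; last exact: ltW.
by rewrite le_eqVlt; apply/orP; left; apply/eqP; field.
Qed.

(** Where [f x] is infinite, so is the right-hand side. *)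
Lemma diff_pow_integral_le (x : T) : mu.-integrable A f ->
  `|f x - (v^-1)%:E * \int[mu]_(y in A) f y| `^ q <=
  (2 `^ q / v)%:E * \int[mu]_(y in A) diff_pow (x, y).
Proof.
move=> intf; have vN0 : v != 0%R by rewrite gt_eqF.
have pv0 : (0 < 2 `^ q / v)%R by rewrite divr_gt0// powR_gt0.
have [fxfin|] := boolP (f x \is a fin_num); last first.
  move=> fxinf.
  have -> : \int[mu]_(y in A) diff_pow (x, y) = +oo.
    by rewrite -[RHS]integral_csty; apply: eq_integral => y _; exact: diff_pow_infinite.
  by rewrite gt0_muley ?lte_fin// leey.
have intd : mu.-integrable A (fun y => f x - f y).
  rewrite -(fineK fxfin); exact: integrableB.
have dfin : \int[mu]_(y in A) `|f x - f y| \is a fin_num.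
  by apply: integrable_fin_num => //; exact: integrable_abse.
pose m := (fine (\int[mu]_(y in A) `|f x - f y|) / v)%R.
have m0 : (0 <= m)%R by rewrite divr_ge0 ?(ltW v0)// fine_ge0// integral_ge0.
have mE : \int[mu]_(y in A) `|f x - f y| = (v * m)%:E.
  by rewrite /m mulrCA divff// mulr1 fineK.
have avg : ((m / 2) `^ q * v)%:E <= \int[mu]_(y in A) diff_pow (x, y).
  apply: average_powR_le mE => //.
  by case/integrableP : intd => mfd _; exact: measurableT_comp.
have [a fxE] : exists a, f x = a%:E by exists (fine (f x)); rewrite fineK.
have [c fE] : exists c, \int[mu]_(y in A) f y = c%:E.
  by exists (fine (\int[mu]_(y in A) f y)); rewrite fineK// integrable_fin_num.
have dm : (`|a - v^-1 * c| <= m)%R.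
  have : `|\int[mu]_(y in A) (f x - f y)| <= (v * m)%:E.
    by rewrite -mE; apply: le_abse_integral => //; case/integrableP : intd.
  rewrite fxE integralB//.
  rewrite integral_cstE fE -EFinB /= lee_fin => h.
  rewrite -(ler_pM2l v0); apply: le_trans h.
  by rewrite -{1}(gtr0_norm v0) -normrM mulrBr mulVKf// [(v * a)%R]mulrC.
rewrite fxE fE -EFinM -EFinB abse_EFin poweR_EFin.
apply: (@le_trans _ _ ((2 `^ q / v)%:E * ((m / 2) `^ q * v)%:E)); last first.
  by rewrite lee_pmul2l ?lte_fin.
rewrite -EFinM lee_fin mulrACA mulVf// mulr1 -powRM//; last by rewrite divr_ge0.
rewrite mulrCA divff// mulr1.
by apply: ge0_ler_powR; rewrite ?nnegrE ?(ltW q0).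
Qed.

Lemma osc_le_diff_pow_integral : mu.-integrable A f ->
  \int[mu]_(x in A) `|f x - (v^-1)%:E * \int[mu]_(y in A) f y| `^ q <=
  (2 `^ q / v)%:E * \int[mu]_(x in A) \int[mu]_(y in A) diff_pow (x, y).
Proof.
move=> intf.
have mF1 := measurable_integral1 mu mA measurable_diff_pow diff_pow_ge0.
have F10 x : 0 <= \int[mu]_(y in A) diff_pow (x, y).
  by apply: integral_ge0 => y _; exact: diff_pow_ge0.
rewrite -[leRHS]ge0_integralZl_EFin//; last 2 first.
- exact: measurable_funTS.
- by rewrite divr_ge0 ?powR_ge0// ltW.
apply: ge0_le_integral => //.
- by move=> x _; exact: poweR_ge0.
- apply: (measurableT_comp (measurable_poweR q)).
  apply: measurableT_comp => //; apply: emeasurable_funB; last exact: measurable_cst.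
  exact: measurable_funTS.
- by apply: measurable_funeM; exact: measurable_funTS.
by move=> x _; exact: diff_pow_integral_le.
Qed.

(** If [f] is not integrable over [A], then the inner integral is infinite for
    every [x]. *)
Lemma integrable_of_diff_pow :
  \int[mu]_(x in A) \int[mu]_(y in A) diff_pow (x, y) < +oo ->
  mu.-integrable A f.
Proof.
move=> Foo; apply/integrableP; split; first exact: measurable_funTS.
rewrite ltey; apply/negP => /eqP foo; move: Foo; rewrite ltey => /negP[].
apply/eqP; rewrite -[RHS]integral_csty; apply: eq_integral => x _.
have mFx : measurable_fun A (fun y => diff_pow (x, y)).
  by apply: measurable_funTS; exact: (measurableT_comp measurable_diff_pow).
have [fxfin|fxinf] := boolP (f x \is a fin_num); last first.
  by rewrite -[RHS]integral_csty; apply: eq_integral => y _; exact: diff_pow_infinite.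
have : +oo <= \int[mu]_(y in A) (((fine `|f x|) + 1)%:E + diff_pow (x, y)).
  rewrite -foo; apply: ge0_le_integral => //.
  - exact/measurableT_comp/measurable_funTS.
  - by apply: emeasurable_funD => //; exact: measurable_cst.
  move=> y _; rewrite /diff_pow/=; case: (f x) fxfin => // a _.
  case: (f y) => [b| |]; last 2 first.
  - by rewrite [`|a%:E - +oo|](_ : _ = +oo)// poweRyr// addey// leey.
  - by rewrite [`|a%:E - -oo|](_ : _ = +oo)// poweRyr// addey// leey.
  rewrite -EFinB !abse_EFin poweR_EFin -EFinD lee_fin/= -addrA.
  have : (`|b| <= `|a| + `|a - b|)%R.
    by rewrite -lerBlDl (le_trans (lerB_dist _ _))// distrC.
  move=> /le_trans; apply; rewrite lerD2l.
  have := @mul_powRB1_le _ _ q1 `|a - b|%R 1%R (normr_ge0 _) ltr01.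
  by rewrite !powR1 mulr1.
rewrite ge0_integralD//; last by move=> y _; exact: diff_pow_ge0.
rewrite integral_cstE leye_eq.
by case: (\int[mu]_(y in A) _).
Qed.

Lemma diff_pow_integral_mean_le (m : R) :
  \int[mu]_(x in A) \int[mu]_(y in A) diff_pow (x, y) <=
  (2 `^ q * 2 * v)%:E * \int[mu]_(x in A) `|f x - m%:E| `^ q.
Proof.
pose g x := `|f x - m%:E| `^ q.
have mg : measurable_fun setT g.
  apply: (measurableT_comp (measurable_poweR q)).
  by apply: measurableT_comp => //; apply: emeasurable_funB.
have g0 x : 0 <= g x by exact: poweR_ge0.
have ig0 : 0 <= \int[mu]_(x in A) g x by exact: integral_ge0.
have pq0 : (0 <= 2 `^ q)%R by exact: powR_ge0.
have mF1 := measurable_integral1 mu mA measurable_diff_pow diff_pow_ge0.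
rewrite -mulrA EFinM -muleA -(iterated_integral_add mA muA mg g0).
have mD x : measurable_fun setT (fun y => g x + g y).
  by apply: emeasurable_funD => //; exact: measurable_cst.
have mDD : measurable_fun setT (fun x => \int[mu]_(y in A) (g x + g y)).
  apply: (@measurable_integral1 _ _ _ mu A (fun z => g z.1 + g z.2)) => //.
    by apply: emeasurable_funD; apply: measurableT_comp.
  by move=> z; exact: adde_ge0.
rewrite -[leRHS]ge0_integralZl_EFin//; last 2 first.
- by move=> x _; apply: integral_ge0 => y _; exact: adde_ge0.
- exact: measurable_funTS.
apply: ge0_le_integral => //.
- by move=> x _; apply: integral_ge0 => y _; exact: diff_pow_ge0.
- exact: measurable_funTS.
- by apply: measurable_funeM; exact: measurable_funTS.
move=> x _; rewrite -[leRHS]ge0_integralZl_EFin//; last 2 first.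
- by move=> y _; exact: adde_ge0.
- exact: measurable_funTS.
apply: ge0_le_integral => //.
- by move=> y _; exact: diff_pow_ge0.
- by apply: measurable_funTS; exact: (measurableT_comp measurable_diff_pow).
- by apply: measurable_funeM; exact: measurable_funTS.
move=> y _; rewrite /g [`|f y - _|]abse_subC; exact: abse_sub_poweR_le.
Qed.

End oscillation.

Section integral_comparison.
Local Open Scope ereal_scope.
Context d (T : measurableType d) (R : realType) (nu : {measure set T -> \bar R}).
Context (D : set T) (mD : measurable D) (g h : T -> \bar R).
Hypotheses (mg : measurable_fun setT g) (mh : measurable_fun setT h).
Hypotheses (g0 : forall z, 0 <= g z) (h0 : forall z, 0 <= h z).

Lemma scaled_integral_le (a c : R) : (0 <= a)%R -> (0 <= c)%R ->
  (forall z, D z -> a%:E * g z <= c%:E * h z) ->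
  a%:E * \int[nu]_(z in D) g z <= c%:E * \int[nu]_(z in D) h z.
Proof.
move=> a0 c0 gh; rewrite -!ge0_integralZl_EFin//; [|exact: measurable_funTS..].
apply: ge0_le_integral => //.
- by move=> z _; rewrite mule_ge0.
- by apply: measurable_funeM; exact: measurable_funTS.
- by apply: measurable_funeM; exact: measurable_funTS.
Qed.

Lemma integral_le_scale (c : R) : (0 <= c)%R ->
  (forall z, D z -> g z <= c%:E * h z) ->
  \int[nu]_(z in D) g z <= c%:E * \int[nu]_(z in D) h z.
Proof.
move=> c0 gh; have := @scaled_integral_le 1 c ler01 c0.
by rewrite mul1e; apply => z Dz; rewrite mul1e; exact: gh.
Qed.

Lemma integral_support : (forall z, ~ D z -> g z = 0) ->
  \int[nu]_z g z = \int[nu]_(z in D) g z.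
Proof.
move=> gD; rewrite [RHS]integral_mkcond; apply: eq_integral => z _; rewrite patchE.
by case: ifPn => // /negP zD; rewrite gD// => Dz; apply: zD; rewrite inE.
Qed.

End integral_comparison.

Section weighted_comparison.
Local Open Scope ereal_scope.
Context d (T : measurableType d) (R : realType) (nu : {measure set T -> \bar R}).
Context (F : T -> \bar R) (mF : measurable_fun setT F) (F0 : forall z, 0 <= F z).
Context (D : set T) (mD : measurable D) (h : T -> \bar R).
Hypotheses (mh : measurable_fun setT h) (h0 : forall z, 0 <= h z).
Context (w : nat -> R) (w0 : forall k, (0 <= w k)%R).

Lemma series_integral_le (o : nat -> T -> R) (c : R) :
  (forall k z, 0 <= o k z)%R -> (forall k, measurable_fun setT (o k)) ->
  (0 <= c)%R -> (forall k z, ~ D z -> o k z = 0%R) ->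
  (forall z, D z -> \sum_(0 <= k <oo) (w k)%:E * (F z * (o k z)%:E) <= c%:E * h z) ->
  \sum_(0 <= k <oo) (w k)%:E * \int[nu]_z (F z * (o k z)%:E) <=
  c%:E * \int[nu]_(z in D) h z.
Proof.
move=> o0 mo c0 oD oh; rewrite series_integral_weight// (@integral_support _ _ _ _ D).
  apply: integral_le_scale => //; first exact: measurable_weighted_series.
  exact: weighted_series_ge0.
by move=> z zD; apply: eseries0 => k _ _; rewrite oD// !mule0.
Qed.

Lemma integral_le_series (U : finType) (o : U -> nat -> T -> R) (a c : R) :
  (forall u k z, 0 <= o u k z)%R -> (forall u k, measurable_fun setT (o u k)) ->
  (0 <= a)%R -> (0 <= c)%R ->
  (forall z, D z -> a%:E * h z <=
    c%:E * \sum_(u : U) \sum_(0 <= k <oo) (w k)%:E * (F z * (o u k z)%:E)) ->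
  a%:E * \int[nu]_(z in D) h z <=
  c%:E * \sum_(u : U) \sum_(0 <= k <oo) (w k)%:E * \int[nu]_z (F z * (o u k z)%:E).
Proof.
move=> o0 mo a0 c0 ho.
pose W u z := \sum_(0 <= k <oo) (w k)%:E * (F z * (o u k z)%:E).
have W0 u z : 0 <= W u z by exact: weighted_series_ge0.
have mW u : measurable_fun setT (W u) by exact: measurable_weighted_series.
have S0 z : 0 <= \sum_(u : U) W u z by exact: sume_ge0.
have mS : measurable_fun setT (fun z => \sum_(u : U) W u z) by exact: emeasurable_sum.
apply: (le_trans (scaled_integral_le nu mD mh mS h0 S0 a0 c0 ho)).
rewrite lee_wpmul2l ?lee_fin//.
under [leRHS]eq_bigr do rewrite series_integral_weight//.
rewrite -[leRHS](ge0_integral_sum nu measurableT mW)//.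
by apply: ge0_subset_integral.
Qed.

End weighted_comparison.

Section far_pairs.
Local Open Scope ereal_scope.
Context d (T : measurableType d) (R : realType).
Variable mu : {sigma_finite_measure set T -> \bar R}.
Context (q : R) (q1 : (1 <= q)%R) (f : T -> \bar R).
Hypothesis mf : measurable_fun setT f.
Context (A : set T) (v : R) (mA : measurable A) (v0 : (0 < v)%R).
Hypothesis muA : mu A = v%:E.
Context (far : set (T * T)) (mfar : measurable far).
Hypothesis farP : forall x y, A x -> A y -> exists Z : set T,
  [/\ measurable Z, Z `<=` A, (v / 2)%:E <= mu Z &
      forall z, Z z -> far (x, z) /\ far (y, z)].

Definition far_osc (x : T) : \bar R :=
  \int[mu]_(z in A) (diff_pow q f (x, z) * (\1_far (x, z))%:E).

Let H (z : T * T) := diff_pow q f z * (\1_far z)%:E.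

Let H0 z : 0 <= H z.
Proof. by rewrite mule_ge0 ?lee_fin// diff_pow_ge0. Qed.

Let mH : measurable_fun setT H.
Proof.
apply: measurable_diff_powM => //.
by apply/measurable_EFinP; exact: measurable_indic.
Qed.

Lemma far_osc_ge0 x : 0 <= far_osc x.
Proof. by apply: integral_ge0 => z _; exact: H0. Qed.

Lemma measurable_far_osc : measurable_fun setT far_osc.
Proof. exact: (measurable_integral1 mu mA mH H0). Qed.

(** Two points of [A] are compared through the many points of [A] that are far
    from both of them. *)
Lemma diff_pow_le_far_osc x y : A x -> A y ->
  diff_pow q f (x, y) <= (2 `^ q * 2 / v)%:E * (far_osc x + far_osc y).
Proof.
move=> Ax Ay; have [Z [mZ ZA vZ Zfar]] := farP Ax Ay.
have mHx u : measurable_fun setT (fun z => H (u, z)) by exact: (measurableT_comp mH).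
have mHxy : measurable_fun setT (fun z => H (x, z) + H (y, z)).
  exact: emeasurable_funD.
have Hxy0 z : 0 <= H (x, z) + H (y, z) by exact: adde_ge0.
have v2 : (0 < v / 2)%R by rewrite divr_gt0.
rewrite -(@lee_pmul2l _ (v / 2)%:E)//.
have -> : (v / 2)%:E * ((2 `^ q * 2 / v)%:E * (far_osc x + far_osc y)) =
    (2 `^ q)%:E * (far_osc x + far_osc y).
  by rewrite muleA -EFinM; congr (_%:E * _); field; rewrite gt_eqF.
have -> : far_osc x + far_osc y = \int[mu]_(z in A) (H (x, z) + H (y, z)).
  by rewrite ge0_integralD//; exact: measurable_funTS.
apply: (@le_trans _ _ ((2 `^ q)%:E * \int[mu]_(z in Z) (H (x, z) + H (y, z)))); last first.
  rewrite lee_pmul2l ?lte_fin ?powR_gt0//; apply: ge0_subset_integral => //.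
  exact: measurable_funTS.
rewrite -ge0_integralZl_EFin//; last exact: measurable_funTS.
apply: (@le_trans _ _ (\int[mu]_(z in Z) diff_pow q f (x, y))).
  have /= -> := integral_cst mu mZ (diff_pow q f (x, y)).
  by rewrite muleC lee_wpmul2l// diff_pow_ge0.
apply: ge0_le_integral => //.
- by move=> z _; exact: diff_pow_ge0.
- by apply: measurable_funeM; exact: measurable_funTS.
move=> z /Zfar[xz yz]; rewrite /H !indicE !mem_set// !mule1.
exact: diff_pow_trans.
Qed.

(** The factor [u / v] is the gain: the two integrations over [J] meet a single
    far oscillation, so one of them only contributes the measure of [J]. *)
Lemma square_osc_le_far_osc (J : set T) (u : R) :
  measurable J -> J `<=` A -> mu J = u%:E ->
  \int[mu]_(x in J) \int[mu]_(y in J) diff_pow q f (x, y) <=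
  (2 `^ q * 4 * (u / v))%:E * \int[mu]_(x in J) far_osc x.
Proof.
move=> mJ JA muJ.
have c0 : (0 <= 2 `^ q * 2 / v)%R by rewrite divr_ge0 ?mulr_ge0 ?powR_ge0// ltW.
have -> : (2 `^ q * 4 * (u / v) = (2 `^ q * 2 / v) * (2 * u))%R.
  by field; rewrite gt_eqF.
rewrite EFinM -muleA.
rewrite -(iterated_integral_add mJ muJ measurable_far_osc far_osc_ge0).
have add0 x y : 0 <= far_osc x + far_osc y by rewrite adde_ge0// far_osc_ge0.
have mD x : measurable_fun setT (fun y => far_osc x + far_osc y).
  apply: emeasurable_funD; first exact: measurable_cst.
  exact: measurable_far_osc.
have mDD : measurable_fun setT (fun x => \int[mu]_(y in J) (far_osc x + far_osc y)).
  apply: (@measurable_integral1 _ _ _ mu J (fun z => far_osc z.1 + far_osc z.2)) => //.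
  by apply: emeasurable_funD; apply: measurableT_comp => //; exact: measurable_far_osc.
rewrite -[leRHS]ge0_integralZl_EFin//; last 2 first.
- by move=> x _; exact: integral_ge0.
- exact: measurable_funTS.
apply: ge0_le_integral => //.
- by move=> x _; apply: integral_ge0 => y _; exact: diff_pow_ge0.
- apply: measurable_funTS.
  exact: (measurable_integral1 mu mJ (measurable_diff_pow q mf) (diff_pow_ge0 q f)).
- by apply: measurable_funeM; exact: measurable_funTS.
move=> x Jx; rewrite -[leRHS]ge0_integralZl_EFin//; last exact: measurable_funTS.
apply: ge0_le_integral => //.
- by move=> y _; exact: diff_pow_ge0.
- apply: measurable_funTS.
  exact: (measurableT_comp (measurable_diff_pow q mf)).
- by apply: measurable_funeM; exact: measurable_funTS.
by move=> y Jy; apply: diff_pow_le_far_osc; exact: JA.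
Qed.

Lemma integral_far_osc_le (h : T * T -> \bar R) (c : R) :
  measurable_fun setT h -> (forall z, 0 <= h z) -> (0 <= c)%R ->
  (forall z, diff_pow q f z * (\1_far z)%:E <= c%:E * h z) ->
  \int[mu]_(x in A) far_osc x <= c%:E * \int[mu \x mu]_(z in A `*` A) h z.
Proof.
move=> mh h0 c0 Hh; rewrite /far_osc (iterated_integralE mu mA mA mH H0).
apply: (integral_le_scale _ (measurableX mA mA) mH mh H0 h0 c0) => z _.
exact: Hh.
Qed.

End far_pairs.

(** * Dyadic energies *)

Section dyadic_energy.
Local Open Scope ereal_scope.
Context (R : realType) (n : nat).
Local Notation mu := (@lebesgue_n R n).
Context (q alpha : R) (q1 : (1 <= q)%R) (f : Rn R n -> \bar R).
Hypothesis mf : measurable_fun setT f.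
Implicit Types (Q J : cube R n) (k : nat).

Local Notation F := (diff_pow q f).
Local Notation s := (n%:R + q * alpha)%R.

Let mF := measurable_diff_pow q mf.
Let F0 := diff_pow_ge0 q f.

Definition volume Q : R := ((edge Q)%:num ^+ n)%R.

Lemma volume_gt0 Q : (0 < volume Q)%R.
Proof. exact: exprn_gt0. Qed.

Lemma inve_lebesgue_cube Q : (mu Q)^-1 = ((volume Q)^-1)%:E.
Proof. by rewrite lebesgue_cube inver gt_eqF// volume_gt0. Qed.

Definition square_osc Q : \bar R := \int[mu \x mu]_(z in cube_set Q `*` cube_set Q) F z.

Lemma square_oscE Q : square_osc Q = \int[mu]_(x in Q) \int[mu]_(y in Q) F (x, y).
Proof. by rewrite iterated_integralE//; exact: measurable_cube. Qed.

Lemma square_osc_ge0 Q : 0 <= square_osc Q.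
Proof. by apply: integral_ge0 => z _; exact: F0. Qed.

Lemma mean_osc_ge0 Q : 0 <= mean_osc q f Q.
Proof.
rewrite /mean_osc; case: ifP => // _.
rewrite inve_lebesgue_cube mule_ge0 ?lee_fin ?invr_ge0 ?(ltW (volume_gt0 _))//.
by apply: integral_ge0 => x _; exact: poweR_ge0.
Qed.

Lemma integrable_cubeP Q :
  mu.-integrable setT (f \_ Q) <-> mu.-integrable Q f.
Proof. by apply: iff_sym; exact: integrable_mkcond (measurable_cube Q). Qed.

(** When the mean oscillation is infinite by convention, [f] is not integrable
    over [Q] and the double integral is infinite as well. *)
Lemma mean_osc_le_square_osc Q :
  mean_osc q f Q <= (2 `^ q)%:E * (((volume Q)^-1 ^+ 2)%:E * square_osc Q).
Proof.
have v0 := volume_gt0 Q; have muQ := lebesgue_cube Q.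
have [/integrable_cubeP fQ|fQ] := pselect (mu.-integrable setT (f \_ Q)); last first.
  have -> : square_osc Q = +oo.
    apply/eqP; rewrite -leye_eq leNgt; apply/negP => sQ; apply: fQ.
    apply/integrable_cubeP; apply: (integrable_of_diff_pow q1 mf _ v0 muQ).
      exact: measurable_cube.
    by rewrite -square_oscE.
  by rewrite !gt0_muley ?leey// lte_fin ?powR_gt0// exprn_gt0// invr_gt0.
rewrite /mean_osc ifT; last by apply/asboolP/integrable_cubeP.
rewrite inve_lebesgue_cube expr2 EFinM -muleA muleCA.
rewrite lee_pmul2l ?lte_fin ?invr_gt0//.
have mQ := measurable_cube Q.
rewrite muleA -EFinM square_oscE /mean inve_lebesgue_cube.
exact: (osc_le_diff_pow_integral q1 mf mQ v0 muQ).
Qed.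

Lemma square_osc_le_mean_osc Q :
  ((volume Q)^-1 ^+ 2)%:E * square_osc Q <= (2 `^ q * 2)%:E * mean_osc q f Q.
Proof.
have v0 := volume_gt0 Q; have mQ := measurable_cube Q.
have muQ : mu Q = (volume Q)%:E := lebesgue_cube Q.
have [fQ|fQ] := pselect (mu.-integrable setT (f \_ Q)); last first.
  rewrite /mean_osc ifF; last by apply/asboolPn.
  by rewrite gt0_muley ?leey// lte_fin mulr_gt0// powR_gt0.
rewrite /mean_osc ifT; last exact/asboolP.
have /integrable_cubeP fQ' := fQ.
have [m mE] : exists m, mean f Q = m%:E.
  exists (fine (mean f Q)); rewrite fineK// /mean inve_lebesgue_cube.
  by rewrite fin_numM// integrable_fin_num.
rewrite mE inve_lebesgue_cube square_oscE.
have := @diff_pow_integral_mean_le _ _ _ mu q q1 f mf Q _ mQ muQ m.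
have c0 : 0 < ((volume Q)^-1 ^+ 2)%:E by rewrite lte_fin exprn_gt0// invr_gt0.
rewrite -(lee_pmul2l _ c0)//.
move=> /le_trans; apply.
rewrite !muleA -!EFinM le_eqVlt; apply/orP; left; apply/eqP; congr (_%:E * _).
by field; rewrite gt_eqF.
Qed.

Definition dyadic_square_osc k Q : \bar R := \sum_(J <- dyadic k Q) square_osc J.

Lemma dyadic_square_osc_ge0 k Q : 0 <= dyadic_square_osc k Q.
Proof. by apply: sume_ge0 => J _; exact: square_osc_ge0. Qed.

(** The [q]-th power of Psi. *)
Definition Psi_pow Q : \bar R :=
  \sum_(0 <= k <oo) (2 `^ ((q * alpha - n%:R) * k%:R))%:E *
                    \sum_(J <- dyadic k Q) mean_osc q f J.

Lemma Psi_pow_ge0 Q : 0 <= Psi_pow Q.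
Proof.
apply: nneseries_ge0 => k _ _; rewrite mule_ge0 ?lee_fin ?powR_ge0//.
by apply: sume_ge0 => J _; exact: mean_osc_ge0.
Qed.

Lemma dyadic_weightE k Q J : J \in dyadic k Q ->
  (2 `^ ((q * alpha - n%:R) * k%:R) * (volume J)^-1 ^+ 2 =
   (volume Q)^-1 ^+ 2 * 2 `^ (s * k%:R))%R.
Proof.
move=> JQ; rewrite /volume (edge_dyadic JQ).
have -> : (s * k%:R = (q * alpha - n%:R) * k%:R + (k * n * 2)%N%:R)%R.
  by rewrite !natrM; ring.
rewrite powRD; last by apply/implyP.
rewrite powR_mulrn// expr_div_n invfM invrK exprMn.
by rewrite mulrCA [(2 ^+ (_ * _ * _))%R]exprM [(2 ^+ (_ * _))%R]exprM.
Qed.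

(** Both the mean oscillations and the normalised square oscillations carry the
    same dyadic weight, so that a comparison of the two on single cubes passes to
    the weighted sums. *)
Lemma Psi_pow_le Q : Psi_pow Q <=
  (2 `^ q * (volume Q)^-1 ^+ 2)%:E *
  \sum_(0 <= k <oo) (2 `^ (s * k%:R))%:E * dyadic_square_osc k Q.
Proof.
have weighted0 k : 0 <= (2 `^ (s * k%:R))%:E * dyadic_square_osc k Q.
  by rewrite mule_ge0 ?lee_fin ?powR_ge0 ?dyadic_square_osc_ge0.
rewrite -nneseriesZl//; apply: lee_nneseries => [k _ _|k _].
  rewrite mule_ge0 ?lee_fin ?powR_ge0//.
  by apply: sume_ge0 => J _; exact: mean_osc_ge0.
rewrite /dyadic_square_osc muleA -EFinM.
rewrite !ge0_sume_distrr; last 2 first.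
- by move=> J _; exact: square_osc_ge0.
- by move=> J _; exact: mean_osc_ge0.
rewrite big_seq [leRHS]big_seq; apply: lee_sum => J JQ.
rewrite -mulrA -(dyadic_weightE JQ) mulrCA EFinM -muleA lee_pmul2l ?lte_fin ?powR_gt0//.
by rewrite EFinM -muleA; exact: mean_osc_le_square_osc.
Qed.

Lemma Psi_pow_ge Q :
  ((volume Q)^-1 ^+ 2)%:E *
    \sum_(0 <= k <oo) (2 `^ (s * k%:R))%:E * dyadic_square_osc k Q <=
  (2 `^ q * 2)%:E * Psi_pow Q.
Proof.
have weighted0 k : 0 <= (2 `^ (s * k%:R))%:E * dyadic_square_osc k Q.
  by rewrite mule_ge0 ?lee_fin ?powR_ge0 ?dyadic_square_osc_ge0.
have weighted1 k : 0 <= (2 `^ ((q * alpha - n%:R) * k%:R))%:E *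
    \sum_(J <- dyadic k Q) mean_osc q f J.
  rewrite mule_ge0 ?lee_fin ?powR_ge0//.
  by apply: sume_ge0 => J _; exact: mean_osc_ge0.
rewrite /Psi_pow -!nneseriesZl//; apply: lee_nneseries => [k _ _|k _].
  by rewrite mule_ge0// lee_fin exprn_ge0// invr_ge0 ltW// volume_gt0.
rewrite /dyadic_square_osc !muleA -!EFinM.
rewrite !ge0_sume_distrr; last 2 first.
- by move=> J _; exact: mean_osc_ge0.
- by move=> J _; exact: square_osc_ge0.
rewrite big_seq [leRHS]big_seq; apply: lee_sum => J JQ.
rewrite -(dyadic_weightE JQ) [X in _ <= X%:E * _]mulrC !EFinM -!muleA.
rewrite lee_pmul2l ?lte_fin ?powR_gt0//.
by rewrite !muleA -!EFinM; exact: square_osc_le_mean_osc.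
Qed.

Lemma dyadic_square_oscE k Q :
  dyadic_square_osc k Q = \int[mu \x mu]_z (F z * (overlap k Q z)%:E).
Proof.
apply: sum_integral_indic => // J.
by apply: measurableX; exact: measurable_cube.
Qed.

End dyadic_energy.

(** * Fractional energy controls the dyadic oscillations *)

Section geometric_sums.
Context {R : realType}.

Lemma powR2_gt1 (s : R) : 0 < s -> 1 < 2 `^ s.
Proof.
move=> s0; have one : 1 `^ s = 1 by rewrite powR1.
by rewrite -[ltLHS]one gt0_ltr_powR// ?nnegrE// ltr1n.
Qed.

Lemma powRV (a s : R) : 0 <= a -> a^-1 `^ s = (a `^ s)^-1.
Proof. by move=> a0; rewrite -powR_inv1// -powRrM mulN1r powRN. Qed.

Lemma powR_antitone (s a b : R) : s <= 0 -> 0 < a -> a <= b -> b `^ s <= a `^ s.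
Proof.
move=> s0 a0 ab; have b0 : 0 < b by exact: lt_le_trans ab.
rewrite -[s]opprK powRN [leRHS]powRN lef_pV2 ?posrE ?powR_gt0//.
by rewrite ge0_ler_powR ?nnegrE ?oppr_ge0// ltW.
Qed.

Lemma powR2M_nat (s : R) k : 2 `^ (s * k%:R) = (2 `^ s) ^+ k.
Proof. by rewrite powRrM powR_mulrn// powR_ge0. Qed.

(** The terms with [2 ^ k <= t] form a geometric sum dominated by its last
    term. *)
Lemma sum_powR2_le (s t : R) (N : nat) : 0 < s -> 0 <= t ->
  \sum_(0 <= k < N) 2 `^ (s * k%:R) * (2 ^+ k <= t)%R%:R <=
  t `^ s / (1 - (2 `^ s)^-1).
Proof.
move=> s0 t0; have a1 := powR2_gt1 s0; set a := 2 `^ s in a1 *.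
have a0 : 0 < a by exact: lt_trans a1.
have r0 : 0 < 1 - a^-1 by rewrite subr_gt0 invf_lt1.
rewrite ler_pdivlMr// mulrC.
(* the second bound is what lets the induction pass through the last term *)
suff [] : (1 - a^-1) * \sum_(0 <= k < N) 2 `^ (s * k%:R) * (2 ^+ k <= t)%R%:R <= t `^ s /\
  (1 - a^-1) * \sum_(0 <= k < N) 2 `^ (s * k%:R) * (2 ^+ k <= t)%R%:R <= a ^+ N / a by [].
elim: N => [|N [IH1 IH2]].
  by rewrite big_geq// mulr0 powR_ge0 divr_ge0// ltW.
have aNa : a ^+ N / a <= a ^+ N.+1 / a.
  by rewrite ler_pM2r ?invr_gt0// ler_eXn2l ?ltW.
rewrite big_nat_recr//= powR2M_nat -/a; case: (leP (2 ^+ N) t) => h; last first.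
  by rewrite mulr0 addr0; split => //; exact: le_trans aNa.
have h' : a ^+ N <= t `^ s.
  by rewrite -powR2M_nat mulrC powRrM powR_mulrn// ge0_ler_powR ?nnegrE ?(ltW s0)// exprn_ge0.
have E : a ^+ N / a + (1 - a^-1) * a ^+ N = a ^+ N.+1 / a.
  by rewrite exprS; field; rewrite gt_eqF.
have Ea : a ^+ N.+1 / a = a ^+ N by rewrite exprS mulrAC divff ?gt_eqF// mul1r.
rewrite mulr1 mulrDr; split; last by rewrite -E lerD2r.
by apply: le_trans h'; rewrite -[leRHS]Ea -E lerD2r.
Qed.

Lemma eseries_geometric_le (a : R) (x : \bar R) : 0 <= a < 1 -> (0 <= x)%E ->
  (\sum_(0 <= k <oo) (a ^+ k)%:E * x <= ((1 - a)^-1)%:E * x)%E.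
Proof.
move=> /andP[a0 a1] x0; apply: lime_le.
  by apply: is_cvg_nneseries => k _ _; rewrite mule_ge0// lee_fin exprn_ge0.
apply: nearW => N; rewrite -ge0_sume_distrl; last first.
  by move=> k _; rewrite lee_fin exprn_ge0.
rewrite sumEFin lee_wpmul2r// lee_fin.
rewrite -[leRHS]mul1r ler_pdivlMr ?subr_gt0// mulrC.
have -> : (1 - a) * \sum_(0 <= k < N) a ^+ k = 1 - a ^+ N.
  rewrite big_mkord; elim: N => [|N IH]; first by rewrite big_ord0 mulr0 subrr.
  by rewrite big_ord_recr/= mulrDr IH exprS; ring.
by rewrite gerBl exprn_ge0.
Qed.

End geometric_sums.

Section fractional_energy.
Local Open Scope ereal_scope.
Context (R : realType) (n : nat) (hn : (0 < n)%N).
Local Notation E := (Rn R n : measurableType _).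
Local Notation mu := (@lebesgue_n R n).
Context (q alpha : R) (q1 : (1 <= q)%R) (f : Rn R n -> \bar R).
Hypothesis mf : measurable_fun setT f.
Implicit Types (Q J : cube R n) (k : nat) (z : E * E).

Local Notation F := (diff_pow q f).
Local Notation s := (n%:R + q * alpha)%R.

Let q0 : (0 < q)%R. Proof. exact: lt_le_trans q1. Qed.

Definition frac_diff z : \bar R := F z / (dist_n z.1 z.2 `^ s)%:E.

(** The bracket in the first norm, before it is raised to the power [p / q]. *)
Definition frac_energy Q : \bar R :=
  mu Q `^ (q * alpha / n%:R - 1) *
  \int[mu]_(x in Q) \int[mu]_(y in Q) frac_diff (x, y).

Lemma inve_powR_ge0 (r a : R) : 0 <= ((r `^ a)%:E)^-1.
Proof. by rewrite inve_ge0 lee_fin powR_ge0. Qed.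

Lemma frac_diff_ge0 z : 0 <= frac_diff z.
Proof. by rewrite mule_ge0 ?diff_pow_ge0// inve_powR_ge0. Qed.

Lemma measurable_frac_diff : measurable_fun setT frac_diff.
Proof.
apply: (measurable_diff_powM q mf); have md := @measurable_dist_n R n.
rewrite (_ : (fun z => _) = (fun z => if dist_n z.1 z.2 == 0%R
    then ((0 `^ s)%:E)^-1 else (dist_n z.1 z.2 `^ (- s))%:E)); last first.
  apply/funext => z; case: eqVneq => [->//|d0].
  by rewrite inver gt_eqF ?powRN// powR_gt0// lt_neqAle eq_sym d0 dist_n_ge0.
apply: measurable_fun_ifT.
- exact: (measurable_fun_eqr md (measurable_cst _)).
- exact: measurable_cst.
- by apply/measurable_EFinP; exact: (measurableT_comp (measurable_powR _) md).
Qed.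

Lemma frac_energyE Q : frac_energy Q =
  ((edge Q)%:num `^ s * (volume Q)^-1 ^+ 2)%:E *
  \int[mu \x mu]_(z in cube_set Q `*` cube_set Q) frac_diff z.
Proof.
rewrite /frac_energy (iterated_integralE mu (measurable_cube Q) (measurable_cube Q)
  measurable_frac_diff frac_diff_ge0).
congr (_ * _); rewrite lebesgue_cube poweR_EFin; congr EFin.
have e0 : (0 < (edge Q)%:num)%R by [].
have -> : ((volume Q)^-1 ^+ 2 = (edge Q)%:num `^ (- (n * 2)%:R))%R.
  by rewrite powR_invn// exprM exprVn.
rewrite -powR_mulrn// -powRrM -powRD; last by rewrite (gt_eqF e0) implybT.
by congr (_ `^ _)%R; rewrite natrM; field; rewrite pnatr_eq0 -lt0n.
Qed.

Lemma frac_energy_ge0 Q : 0 <= frac_energy Q.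
Proof.
rewrite /frac_energy mule_ge0 ?poweR_ge0//.
by apply: integral_ge0 => x _; apply: integral_ge0 => y _; exact: frac_diff_ge0.
Qed.

Lemma overlap_le_near k Q x y : (0 < dist_n x y)%R ->
  (overlap k Q (x, y) <=
   (2 ^+ k <= n%:R * (edge Q)%:num / dist_n x y)%R%:R)%R.
Proof.
move=> d0; case: (leP (2 ^+ k)%R (n%:R * (edge Q)%:num / dist_n x y)%R) => h /=.
  by apply: le_trans (overlap_le _ _ _) _; rewrite indicE lern1 leq_b1.
rewrite overlap_far//= mulrA ltr_pdivrMr ?exprn_gt0//.
by rewrite [ltRHS]mulrC -ltr_pdivrMr.
Qed.

Lemma sum_overlap_le N Q x y : (0 < s)%R -> (0 < dist_n x y)%R ->
  (\sum_(0 <= k < N) 2 `^ (s * k%:R) * overlap k Q (x, y) <=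
   n%:R `^ s / (1 - (2 `^ s)^-1) * (edge Q)%:num `^ s / dist_n x y `^ s)%R.
Proof.
move=> s0 d0.
have e0 : (0 <= n%:R * (edge Q)%:num / dist_n x y)%R.
  by rewrite divr_ge0 ?mulr_ge0// ltW.
apply: le_trans (le_trans (sum_powR2_le N s0 e0) _).
  apply: ler_sum => k _; rewrite ler_wpM2l ?powR_ge0//.
  exact: overlap_le_near.
rewrite powRM ?mulr_ge0 ?invr_ge0 ?(ltW d0)// powRM// powRV ?(ltW d0)//.
rewrite le_eqVlt; apply/orP; left; apply/eqP.
by rewrite mulrAC; congr (_ / _)%R; exact: mulrAC.
Qed.

Definition weight_constant_pos : R := (n%:R `^ s / (1 - (2 `^ s)^-1))%R.

Lemma weight_constant_pos_gt0 : (0 < s)%R -> (0 < weight_constant_pos)%R.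
Proof.
move=> s0; rewrite divr_gt0 ?powR_gt0 ?ltr0n//.
by rewrite subr_gt0 invf_lt1 ?powR_gt0// powR2_gt1.
Qed.

(** On the diagonal, [F] is zero or infinite, and in the second case the
    right-hand side is infinite since [s > 0]. *)
Lemma weighted_overlap_le_frac_diff Q z : (0 < s)%R ->
  \sum_(0 <= k <oo) (2 `^ (s * k%:R))%:E * (F z * (overlap k Q z)%:E) <=
  (weight_constant_pos * (edge Q)%:num `^ s)%:E * frac_diff z.
Proof.
case: z => x y s0.
have C0 : (0 < weight_constant_pos * (edge Q)%:num `^ s)%R.
  by rewrite mulr_gt0 ?powR_gt0// weight_constant_pos_gt0.
have sN0 : s != 0%R by rewrite gt_eqF.
have [d0|dN0] := eqVneq (dist_n x y) 0%R.
  have xy := dist_n_eq0 d0; rewrite /frac_diff d0 powR0// inver eqxx /=.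
  rewrite {}xy; case: (diff_pow_diag q1 f y) => ->.
    by rewrite mul0e mule0 eseries0// => k _ _; rewrite mul0e mule0.
  by rewrite mulyy gt0_muley ?leey.
have d0 : (0 < dist_n x y)%R by rewrite lt_neqAle eq_sym dN0 dist_n_ge0.
apply: lime_le.
  apply: is_cvg_nneseries => k _ _.
  by rewrite !mule_ge0 ?lee_fin ?powR_ge0 ?diff_pow_ge0 ?overlap_ge0.
apply: nearW => N.
under eq_bigr do rewrite muleCA -EFinM.
rewrite -ge0_sume_distrr; last first.
  by move=> k _; rewrite lee_fin mulr_ge0 ?powR_ge0 ?overlap_ge0.
rewrite sumEFin /frac_diff inver gt_eqF ?powR_gt0//= muleCA -EFinM.
by rewrite lee_wpmul2l ?diff_pow_ge0// lee_fin; exact: sum_overlap_le.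
Qed.

Lemma overlap_out k Q z : ~ (cube_set Q `*` cube_set Q) z -> overlap k Q z = 0%R.
Proof.
move=> zQ; apply/eqP; rewrite eq_le overlap_ge0 andbT.
by have := overlap_le k Q z; rewrite indicE memNset.
Qed.

Lemma weighted_square_osc_le_pos Q : (0 < s)%R ->
  \sum_(0 <= k <oo) (2 `^ (s * k%:R))%:E * dyadic_square_osc q f k Q <=
  (weight_constant_pos * (edge Q)%:num `^ s)%:E *
  \int[mu \x mu]_(z in cube_set Q `*` cube_set Q) frac_diff z.
Proof.
move=> s0; under eq_eseriesr do rewrite (dyadic_square_oscE q mf).
apply: (series_integral_le _ (measurable_diff_pow q mf) (diff_pow_ge0 q f)
  (measurableX (measurable_cube Q) (measurable_cube Q)) measurable_frac_diff
  frac_diff_ge0 (fun k => powR_ge0 _ _)).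
- by move=> k z; exact: overlap_ge0.
- by move=> k; exact: measurable_overlap.
- by rewrite mulr_ge0 ?powR_ge0// ltW// weight_constant_pos_gt0.
- by move=> k z; exact: overlap_out.
- by move=> z _; exact: weighted_overlap_le_frac_diff.
Qed.

(** Used with two cubes of a quarter of the edge, which remove at most half of
    the measure. *)
Lemma measure_remove_two (d : measure_display) (T : measurableType d)
    (nu : {measure set T -> \bar R}) (A B C : set T) (v : R) :
  measurable A -> measurable B -> measurable C -> nu A = v%:E ->
  nu B <= (v / 4)%:E -> nu C <= (v / 4)%:E ->
  (v / 2)%:E <= nu (A `\` (B `|` C)).
Proof.
move=> mA mB mC nuA nuB nuC; have mBC := measurableU _ _ mB mC.
have : nu A <= nu (A `\` (B `|` C)) + (v / 2)%:E.
  rewrite (measureDI nu mA mBC) leeD2l//.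
  apply: (@le_trans _ _ (nu (B `|` C))).
    by apply: le_measure; rewrite ?inE//; exact: measurableI.
  apply: (le_trans (measureU2 nu mB mC)).
  rewrite (_ : (v / 2)%:E = (v / 4)%:E + (v / 4)%:E); last first.
    by rewrite -EFinD; congr EFin; field.
  exact: leeD.
rewrite nuA -leeBlDr//; apply: le_trans.
by rewrite -EFinB lee_fin; lra.
Qed.

Definition ball_cube (x : Rn R n) (r : {posnum R}) : cube R n := {|
  corner := fun i => (tnth x i - r%:num / 2)%R ;
  edge := r ;
  lclosed := fun=> true ;
  rclosed := fun=> true |}.

Lemma ball_cube_far x r y : ~ (cube_set (ball_cube x r)) y ->
  (r%:num / 2 <= dist_n x y)%R.
Proof.
move=> /existsNP[i]; rewrite /cube_itv /= in_itv/= => /negP yi.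
apply: le_trans (coord_le_dist x y i); rewrite leNgt; apply: contra yi.
by move=> /ltr_normlP[h1 h2]; apply/andP; split; lra.
Qed.

Definition far_pair Q : set (E * E) :=
  [set z | ((edge Q)%:num / 8 <= dist_n z.1 z.2)%R].

Lemma measurable_far_pair Q : measurable (far_pair Q).
Proof.
have -> : far_pair Q = (fun z => dist_n z.1 z.2) @^-1` `[((edge Q)%:num / 8)%R, +oo[.
  by apply/seteqP; split => z; rewrite /far_pair/= in_itv/= andbT.
rewrite -[X in measurable X]setTI; exact: measurable_dist_n.
Qed.

(** The cubes of edge [l / 4] centred at [x] and [y] cover at most half of
    [Q], and outside them both distances are at least [l / 8]. *)
Lemma far_pairP Q x y : exists Z : set (Rn R n),
  [/\ measurable Z, Z `<=` Q, (volume Q / 2)%:E <= mu Z &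
      forall z : Rn R n, Z z -> far_pair Q (x, z) /\ far_pair Q (y, z)].
Proof.
have e4 : (0 < (edge Q)%:num / 4)%R by [].
pose r := PosNum e4.
have small u : mu (ball_cube u r) <= (volume Q / 4)%:E.
  rewrite lebesgue_cube lee_fin /= expr_div_n ler_pM2l ?exprn_gt0//.
  rewrite lef_pV2 ?posrE ?exprn_gt0//.
  by case: n hn => // m _; rewrite exprS ler_peMr// exprn_ege1// ler1n.
exists (cube_set Q `\` (cube_set (ball_cube x r) `|` cube_set (ball_cube y r))); split.
- apply: measurableD; first exact: measurable_cube.
  by apply: measurableU; exact: measurable_cube.
- by move=> z [].
- apply: measure_remove_two;
    [exact: measurable_cube..|exact: lebesgue_cube|exact: small|exact: small].
- move=> z [_ /not_orP[zx zy]]; rewrite /far_pair /=.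
  have e8 : ((edge Q)%:num / 8 = r%:num / 2)%R by rewrite /=; field.
  by rewrite !e8; split; exact: ball_cube_far.
Qed.

Lemma far_le_frac_diff Q z : (s <= 0)%R ->
  F z * (\1_(far_pair Q) z)%:E <=
  (8 `^ (- s) * (edge Q)%:num `^ s)%:E * frac_diff z.
Proof.
move=> s0.
have c0 : (0 <= 8 `^ (- s) * (edge Q)%:num `^ s)%R by rewrite mulr_ge0 ?powR_ge0.
rewrite indicE; case: (boolP (z \in _)) => [|_]; last first.
  by rewrite mule0 mule_ge0 ?frac_diff_ge0.
rewrite inE /far_pair /= => zQ.
have e8 : (0 < (edge Q)%:num / 8)%R by [].
have d0 : (0 < dist_n z.1 z.2)%R by exact: lt_le_trans zQ.
rewrite mule1 /frac_diff inver gt_eqF ?powR_gt0// muleCA -EFinM -[leLHS]mule1.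
rewrite lee_wpmul2l ?diff_pow_ge0// lee_fin ler_pdivlMr ?powR_gt0// mul1r.
have -> : (8 `^ (- s) * (edge Q)%:num `^ s = ((edge Q)%:num / 8) `^ s)%R.
  by rewrite powRM// powRV// powRN mulrC.
exact: powR_antitone.
Qed.

Definition weight_constant_neg : R :=
  (2 `^ q * 4 * 8 `^ (- s) / (1 - 2 `^ (q * alpha)))%R.

Lemma qalpha_lt0 : (s <= 0)%R -> (q * alpha < 0)%R.
Proof.
by move=> s0; rewrite (lt_le_trans _ s0)// ltrDr ltr0n.
Qed.

Lemma powR2_lt1 : (s <= 0)%R -> (2 `^ (q * alpha) < 1 :> R)%R.
Proof.
move=> /qalpha_lt0; rewrite -oppr_gt0 => /powR2_gt1; rewrite powRN.
by rewrite invf_gt1 // powR_gt0.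
Qed.

Lemma weight_constant_neg_gt0 : (s <= 0)%R -> (0 < weight_constant_neg)%R.
Proof.
by move=> s0; rewrite divr_gt0 ?mulr_gt0 ?powR_gt0// subr_gt0 powR2_lt1.
Qed.

(** The gain [2 ^ (- n k)] is the ratio of the volume of a subcube of level [k]
    to that of [Q]. *)
Lemma dyadic_square_osc_le_neg k Q : (s <= 0)%R ->
  dyadic_square_osc q f k Q <=
  (2 `^ q * 4 * 2 `^ (- n%:R * k%:R) * (8 `^ (- s) * (edge Q)%:num `^ s))%:E *
  \int[mu \x mu]_(z in cube_set Q `*` cube_set Q) frac_diff z.
Proof.
move=> s0; have mQ := measurable_cube Q; have mfar := measurable_far_pair Q.
pose G := far_osc mu q f (cube_set Q) (far_pair Q).
have mG : measurable_fun setT G by exact: measurable_far_osc.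
have G0 x : 0 <= G x by exact: far_osc_ge0.
have c0 : (0 <= 2 `^ q * 4 * 2 `^ (- n%:R * k%:R))%R by rewrite !mulr_ge0 ?powR_ge0.
have c1 : (0 <= 8 `^ (- s) * (edge Q)%:num `^ s)%R by rewrite mulr_ge0 ?powR_ge0.
apply: (@le_trans _ _ ((2 `^ q * 4 * 2 `^ (- n%:R * k%:R))%:E *
    \sum_(J <- dyadic k Q) \int[mu]_(x in J) G x)).
  rewrite ge0_sume_distrr; last by move=> J _; apply: integral_ge0.
  rewrite /dyadic_square_osc big_seq [leRHS]big_seq; apply: lee_sum => J JQ.
  rewrite square_oscE//.
  have := @square_osc_le_far_osc _ _ _ mu q q1 f mf (cube_set Q) (volume Q) mQ
    (volume_gt0 Q) (far_pair Q) mfar (fun x y _ _ => far_pairP Q x y) (cube_set J)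
    (volume J) (measurable_cube J) (dyadic_subset JQ) (lebesgue_cube J).
  rewrite (_ : (volume J / volume Q = 2 `^ (- n%:R * k%:R))%R)//.
  rewrite mulNr -natrM powR_invn// /volume (edge_dyadic JQ) expr_div_n -exprM mulnC.
  by rewrite mulrC mulKf// gt_eqF// exprn_gt0.
rewrite [in leRHS]EFinM -[leRHS]muleA lee_wpmul2l ?lee_fin//.
rewrite sum_integral_indic//; last by move=> J; exact: measurable_cube.
under eq_integral => x _ do rewrite sum_indic_dyadic.
rewrite (_ : \int[mu]_x _ = \int[mu]_(x in Q) G x); last first.
  by rewrite [RHS]integral_mkcond epatch_indic.
apply: (integral_far_osc_le _ mf mQ mfar measurable_frac_diff frac_diff_ge0 c1) => z.
exact: far_le_frac_diff.
Qed.

Lemma weighted_square_osc_le_neg Q : (s <= 0)%R ->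
  \sum_(0 <= k <oo) (2 `^ (s * k%:R))%:E * dyadic_square_osc q f k Q <=
  (weight_constant_neg * (edge Q)%:num `^ s)%:E *
  \int[mu \x mu]_(z in cube_set Q `*` cube_set Q) frac_diff z.
Proof.
move=> s0; have a1 := powR2_lt1 s0; have a0 := powR_ge0 2 (q * alpha).
set I := \int[_]_(z in _) _.
have I0 : 0 <= I by apply: integral_ge0 => z _; exact: frac_diff_ge0.
pose c := (2 `^ q * 4 * (8 `^ (- s) * (edge Q)%:num `^ s))%R.
have c0 : (0 <= c)%R by rewrite !mulr_ge0 ?powR_ge0.
apply: (@le_trans _ _ (\sum_(0 <= k <oo) c%:E * ((2 `^ (q * alpha) ^+ k)%:E * I))).
  apply: lee_nneseries => [k _ _|k _].
    by rewrite mule_ge0 ?lee_fin ?powR_ge0 ?dyadic_square_osc_ge0.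
  apply: (@le_trans _ _ ((2 `^ (s * k%:R))%:E * ((2 `^ q * 4 * 2 `^ (- n%:R * k%:R) *
      (8 `^ (- s) * (edge Q)%:num `^ s))%:E * I))).
    by rewrite lee_wpmul2l ?lee_fin ?powR_ge0//; exact: dyadic_square_osc_le_neg.
  rewrite !muleA -!EFinM le_eqVlt; apply/orP; left; apply/eqP; congr (_%:E * _).
  rewrite -powR2M_nat (_ : q * alpha * k%:R = s * k%:R + (- n%:R * k%:R))%R; last by ring.
  rewrite [in RHS]powRD; last by apply/implyP.
  by rewrite /c; ring.
rewrite nneseriesZl; last by move=> k _; rewrite mule_ge0// lee_fin exprn_ge0.
apply: (@le_trans _ _ (c%:E * (((1 - 2 `^ (q * alpha))^-1)%:E * I))).
  by rewrite lee_wpmul2l// eseries_geometric_le// a0.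
rewrite muleA -EFinM le_eqVlt; apply/orP; left; apply/eqP; congr (_%:E * _).
by rewrite /weight_constant_neg /c; ring.
Qed.

Definition Psi_constant : R :=
  (2 `^ q * (if 0 < s then weight_constant_pos else weight_constant_neg))%R.

Lemma Psi_constant_gt0 : (0 < Psi_constant)%R.
Proof.
rewrite mulr_gt0 ?powR_gt0//; case: (ltP 0%R s) => s0.
  exact: weight_constant_pos_gt0.
exact: weight_constant_neg_gt0.
Qed.

Lemma Psi_pow_le_frac_energy Q :
  Psi_pow q alpha f Q <= Psi_constant%:E * frac_energy Q.
Proof.
apply: le_trans (Psi_pow_le alpha q1 mf Q) _.
rewrite frac_energyE /Psi_constant.
set c := if _ then _ else _.
have v0 : (0 < (volume Q)^-1 ^+ 2)%R by rewrite exprn_gt0// invr_gt0 volume_gt0.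
set I := \int[_]_(z in _) _.
have key : \sum_(0 <= k <oo) (2 `^ (s * k%:R))%:E * dyadic_square_osc q f k Q <=
    (c * (edge Q)%:num `^ s)%:E * I.
  rewrite /c; case: (ltP 0%R s) => s0.
    exact: weighted_square_osc_le_pos.
  exact: weighted_square_osc_le_neg.
have -> : (2 `^ q * c)%:E * (((edge Q)%:num `^ s * (volume Q)^-1 ^+ 2)%:E * I) =
    (2 `^ q * (volume Q)^-1 ^+ 2)%:E * ((c * (edge Q)%:num `^ s)%:E * I).
  by rewrite !muleA -!EFinM; congr (_%:E * _); ring.
by rewrite lee_wpmul2l// lee_fin mulr_ge0 ?powR_ge0// ltW.
Qed.

(** * Dyadic oscillations of neighbouring cubes control the fractional energy *)

(** The cube [Q] itself serves, at level 0, the pairs whose distance is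
    comparable to the edge; its half-open translates serve the closer ones. *)
Definition neighbor Q (u : option {ffun 'I_n -> bool * bool}) : cube R n :=
  if u is Some b then shifted_cube Q b else Q.

Lemma edge_neighbor Q u : edge (neighbor Q u) = edge Q.
Proof. by case: u. Qed.

(** The index is the level attached to a distance. *)
Lemma exists_pow2_lt (t : R) : (1 < t)%R -> exists k, (2 ^+ k < t <= 2 ^+ k.+1)%R.
Proof.
move=> t1; have ext : exists m, (t <= 2 ^+ m)%R.
  exists (Num.truncn t).+1; rewrite ltW// (lt_trans (truncnS_gt t))//.
  by rewrite -natrX ltr_nat ltn_expl.
case: (ex_minnP ext) => -[|k] tk kmin; first by rewrite leNgt expr0 t1 in tk.
by exists k; rewrite tk andbT ltNge; apply/negP => /kmin; rewrite ltnn.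
Qed.

Definition kernel_constant : R := (if 0 < s then 6 `^ s else n%:R `^ (- s))%R.

Lemma kernel_constant_gt0 : (0 < kernel_constant)%R.
Proof. by rewrite /kernel_constant; case: ifP => _; rewrite powR_gt0// ltr0n. Qed.

Lemma overlap0_self Q x y : x \in cube_set Q -> y \in cube_set Q ->
  (1 <= overlap 0 (neighbor Q None) (x, y))%R.
Proof. by move=> xQ yQ; apply: (@overlap_ge1 _ _ 0 Q Q) => //=; rewrite mem_seq1. Qed.

(** A pair at distance about [2 ^- k] times the edge of [Q] lies in a common
    dyadic subcube of level [k] of one of the neighbours. *)
Lemma exists_common_cube Q x y : x \in cube_set Q -> y \in cube_set Q ->
  (0 < dist_n x y)%R -> exists u k, (1 <= overlap k (neighbor Q u) (x, y))%R /\
    ((edge Q)%:num `^ s / dist_n x y `^ s <= kernel_constant * 2 `^ (s * k%:R))%R.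
Proof.
move=> xQ yQ d0; have self := overlap0_self xQ yQ.
have e0 : (0 < (edge Q)%:num)%R by [].
have ratioE : ((edge Q)%:num `^ s / dist_n x y `^ s =
               ((edge Q)%:num / dist_n x y) `^ s)%R.
  by rewrite powRM ?invr_ge0 ?(ltW d0)// powRV ?(ltW d0).
rewrite {}ratioE /kernel_constant; case: (ltP 0%R s) => s0; last first.
  exists None, 0%N; split => //; rewrite mulr0 powRr0 mulr1.
  rewrite powRN -powRV//; apply: powR_antitone => //; first by rewrite invr_gt0 ltr0n.
  rewrite ler_pdivlMr// -ler_pdivlMl ?invr_gt0 ?ltr0n// invrK.
  apply: dist_le_coord; first exact: ltW.
  by move=> i; exact: cube_coord_dist.
have mono a b : (0 <= a -> a <= b -> a `^ s <= b `^ s)%R.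
  move=> a0 ab; apply: ge0_ler_powR; rewrite ?nnegrE ?(ltW s0)//.
  exact: le_trans ab.
have r0 : (0 <= (edge Q)%:num / dist_n x y)%R by rewrite divr_ge0// ltW.
have [far|near] := leP ((edge Q)%:num / 3)%R (dist_n x y).
  exists None, 0%N; split => //; rewrite mulr0 powRr0 mulr1; apply: mono => //.
  rewrite ler_pdivrMr//; lra.
have t1 : (1 < (edge Q)%:num / (3 * dist_n x y))%R.
  rewrite ltr_pdivlMr ?mulr_gt0//; lra.
have [k /andP[k1 k2]] := exists_pow2_lt t1.
have p0 : (0 < 2 ^+ k :> R)%R by rewrite exprn_gt0.
have [b [J JQ [xJ yJ]]] : exists b, exists2 J, J \in dyadic k (shifted_cube Q b) &
    x \in cube_set J /\ y \in cube_set J.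
  apply: one_third_cube => // i; apply: le_lt_trans (coord_le_dist x y i) _.
  move: k1; rewrite !ltr_pdivlMr ?mulr_gt0//; lra.
exists (Some b), k; split; first exact: overlap_ge1 JQ xJ yJ.
(* the constant 6 is 3, from the thirds, times 2, from the rounding to a level *)
rewrite [leRHS]mulrC powRrM powRAC powR_mulrn// -powRM ?(ltW p0)//.
apply: mono => //; move: k2; rewrite exprS !ler_pdivrMr ?mulr_gt0//; lra.
Qed.

Definition neighbor_sum Q z : \bar R :=
  \sum_(u : option {ffun 'I_n -> bool * bool})
    \sum_(0 <= k <oo) (2 `^ (s * k%:R))%:E * (F z * (overlap k (neighbor Q u) z)%:E).

Lemma neighbor_term_ge0 Q u k z :
  0 <= (2 `^ (s * k%:R))%:E * (F z * (overlap k (neighbor Q u) z)%:E).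
Proof. by rewrite !mule_ge0 ?lee_fin ?powR_ge0 ?diff_pow_ge0 ?overlap_ge0. Qed.

Lemma neighbor_sum_ge Q u k z : (1 <= overlap k (neighbor Q u) z)%R ->
  (2 `^ (s * k%:R))%:E * F z <= neighbor_sum Q z.
Proof.
move=> ov; rewrite /neighbor_sum (bigD1 u)//=.
apply: (@le_trans _ _ ((2 `^ (s * k%:R))%:E * (F z * (overlap k (neighbor Q u) z)%:E))).
  rewrite lee_wpmul2l ?lee_fin ?powR_ge0// -[leLHS]mule1.
  by rewrite lee_wpmul2l ?diff_pow_ge0.
apply: (@le_trans _ _ (\sum_(0 <= j <oo)
    (2 `^ (s * j%:R))%:E * (F z * (overlap j (neighbor Q u) z)%:E))).
  rewrite [leRHS](@nneseriesD1 _ _ k)//; last by move=> j _; exact: neighbor_term_ge0.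
  by rewrite leeDl// nneseries_ge0// => j _ _; exact: neighbor_term_ge0.
rewrite leeDl// sume_ge0// => w _; apply: nneseries_ge0 => j _ _.
exact: neighbor_term_ge0.
Qed.

Lemma frac_diff_le_neighbor_sum Q x y : x \in cube_set Q -> y \in cube_set Q ->
  ((edge Q)%:num `^ s)%:E * frac_diff (x, y) <=
  kernel_constant%:E * neighbor_sum Q (x, y).
Proof.
move=> xQ yQ; have C0 := kernel_constant_gt0.
have es0 : (0 < (edge Q)%:num `^ s)%R by rewrite powR_gt0.
have [dxy|dN0] := eqVneq (dist_n x y) 0%R.
  have xy := dist_n_eq0 dxy; have self := overlap0_self xQ yQ; subst y.
  case: (diff_pow_diag q1 f x) => Fx.
    rewrite /frac_diff Fx mul0e mule0 mule_ge0 ?lee_fin ?(ltW C0)//.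
    by apply: le_trans (neighbor_sum_ge self); rewrite Fx mule0.
  have := neighbor_sum_ge self; rewrite Fx mulr0 powRr0 mul1e leye_eq => /eqP ->.
  by rewrite gt0_muley ?leey// lte_fin.
have d0 : (0 < dist_n x y)%R by rewrite lt_neqAle eq_sym dN0 dist_n_ge0.
have [u [k [ov bound]]] := exists_common_cube xQ yQ d0.
apply: (@le_trans _ _ (kernel_constant%:E * ((2 `^ (s * k%:R))%:E * F (x, y)))).
  rewrite /frac_diff inver gt_eqF ?powR_gt0//= muleCA -EFinM muleA -EFinM muleC.
  by rewrite lee_wpmul2r ?diff_pow_ge0// lee_fin.
by rewrite lee_wpmul2l ?lee_fin ?(ltW C0)//; exact: (neighbor_sum_ge ov).
Qed.

Lemma volume_neighbor Q u : volume (neighbor Q u) = volume Q.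
Proof. by rewrite /volume edge_neighbor. Qed.

Lemma frac_energy_le_Psi_pow Q :
  frac_energy Q <= (kernel_constant * (2 `^ q * 2))%:E *
    \sum_(u : option {ffun 'I_n -> bool * bool}) Psi_pow q alpha f (neighbor Q u).
Proof.
have C0 := kernel_constant_gt0; have mQ := measurable_cube Q.
have v0 : (0 < (volume Q)^-1 ^+ 2)%R by rewrite exprn_gt0// invr_gt0 volume_gt0.
have es0 : (0 < (edge Q)%:num `^ s)%R by rewrite powR_gt0.
set I := \int[mu \x mu]_(z in cube_set Q `*` cube_set Q) frac_diff z.
have key : ((edge Q)%:num `^ s)%:E * I <= kernel_constant%:E *
    \sum_(u : option {ffun 'I_n -> bool * bool})
      \sum_(0 <= k <oo) (2 `^ (s * k%:R))%:E * dyadic_square_osc q f k (neighbor Q u).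
  under eq_bigr do under eq_eseriesr do rewrite (dyadic_square_oscE q mf).
  apply: (integral_le_series _ (measurable_diff_pow q mf) (diff_pow_ge0 q f)
    (measurableX mQ mQ) measurable_frac_diff frac_diff_ge0 (fun k => powR_ge0 _ _)).
  - by move=> u k z; exact: overlap_ge0.
  - by move=> u k; exact: measurable_overlap.
  - exact: ltW.
  - exact: ltW.
  - by case=> x y [xQ yQ]; apply: frac_diff_le_neighbor_sum; rewrite inE.
have -> : frac_energy Q =
    ((volume Q)^-1 ^+ 2)%:E * (((edge Q)%:num `^ s)%:E * I).
  by rewrite frac_energyE muleA -EFinM mulrC.
apply: (@le_trans _ _ (((volume Q)^-1 ^+ 2)%:E * (kernel_constant%:E *
    \sum_(u : option {ffun 'I_n -> bool * bool})
      \sum_(0 <= k <oo) (2 `^ (s * k%:R))%:E *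
        dyadic_square_osc q f k (neighbor Q u)))).
  by rewrite lee_wpmul2l// lee_fin ltW.
rewrite muleCA [in leRHS]EFinM -[leRHS]muleA.
apply: lee_wpmul2l; first by rewrite lee_fin ltW.
rewrite !ge0_sume_distrr; last 2 first.
- by move=> u _; exact: Psi_pow_ge0.
- move=> u _; apply: nneseries_ge0 => k _ _.
  by rewrite mule_ge0 ?lee_fin ?powR_ge0 ?dyadic_square_osc_ge0.
apply: lee_sum => u _; rewrite -(volume_neighbor Q u).
exact: Psi_pow_ge.
Qed.

End fractional_energy.

(** * Families of cubes *)

Section translated_families.
Context {R : realType} {n : nat}.
Implicit Types (Q : cube R n) (x y : Rn R n) (F : set (cube R n)).

Definition shift_coord x (i : 'I_n) (t : R) : Rn R n :=
  [tuple (if j == i then tnth x i + t else tnth x j) | j < n].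

Lemma dist_shift_coord x i t : dist_n x (shift_coord x i t) = `|t|.
Proof.
rewrite /dist_n (bigD1 i)//= big1 ?addr0 => [|j /negbTE ji]; last first.
  by rewrite tnth_mktuple ji subrr expr0n.
by rewrite tnth_mktuple eqxx opprD addNKr sqrrN sqrtr_sqr.
Qed.

(** A Euclidean ball around an interior point contains its displacements along
    each axis, which gives the strict inequalities. *)
Lemma interior_cubeP Q x : interior_n (cube_set Q) x <->
  forall i, corner Q i < tnth x i < corner Q i + (edge Q)%:num.
Proof.
split=> [[r r0 rQ] i|xQ].
  have inQ t : `|t| < r -> corner Q i <= tnth x i + t <= corner Q i + (edge Q)%:num.
    move=> tr; have /mem_set/(cube_coordP i) : cube_set Q (shift_coord x i t).
      by apply: rQ; rewrite /= dist_shift_coord.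
    by rewrite tnth_mktuple eqxx.
  have /inQ/andP[_ h1] : `|r / 2| < r by rewrite gtr0_norm ?divr_gt0//; lra.
  have /inQ/andP[h2 _] : `|- (r / 2)| < r by rewrite normrN gtr0_norm ?divr_gt0//; lra.
  by apply/andP; split; lra.
pose gap i := Num.min (tnth x i - corner Q i) (corner Q i + (edge Q)%:num - tnth x i).
have gap0 i : 0 < gap i.
  by have /andP[h1 h2] := xQ i; rewrite lt_min !subr_gt0 h1.
pose r := \big[Num.min/1]_i gap i.
exists r => [|y /= xyr i].
  by rewrite /r; elim/big_ind : _ => // a b a0 b0; rewrite lt_min a0.
have rgap : r <= gap i by exact: bigmin_le_cond.
have /lt_le_trans/(_ rgap) := le_lt_trans (coord_le_dist x y i) xyr.
rewrite lt_min => /andP[/ltr_normlP[h1 h2] /ltr_normlP[h3 h4]].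
rewrite itv_boundlr; apply/andP; split.
  by case: lclosed; rewrite bnd_simp; lra.
by case: rclosed; rewrite /= bnd_simp; lra.
Qed.

Lemma interior_cube_neq0 Q : interior_n (cube_set Q) !=set0.
Proof.
exists [tuple corner Q i + (edge Q)%:num / 2 | i < n].
have e0 : 0 < (edge Q)%:num by [].
by apply/interior_cubeP => i; rewrite tnth_mktuple; apply/andP; split; lra.
Qed.

Definition shift_vector (l : R) (u : option {ffun 'I_n -> bool * bool}) (i : 'I_n) : R :=
  if u is Some b then l * third (b i) else 0.

Lemma interior_neighbor Q u y : interior_n (cube_set (neighbor Q u)) y ->
  interior_n (cube_set Q) [tuple tnth y i - shift_vector (edge Q)%:num u i | i < n].
Proof.
move=> /interior_cubeP yQ; apply/interior_cubeP => i; rewrite tnth_mktuple.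
by move: (yQ i); case: u {yQ} => [b|] /= /andP[h1 h2]; apply/andP; split; lra.
Qed.

Lemma neighbor_same_interior l F Q Q' u y : cube_family l F -> F Q -> F Q' ->
  interior_n (cube_set (neighbor Q u)) y ->
  interior_n (cube_set (neighbor Q' u)) y -> Q = Q'.
Proof.
move=> [Fl Ftriv] FQ FQ' /interior_neighbor yQ /interior_neighbor yQ'.
apply: Ftriv => //; exists [tuple tnth y i - shift_vector l u i | i < n].
by split; [move: yQ|move: yQ']; rewrite Fl.
Qed.

(** A cube of the family can be recovered from its neighbour, since the interior
    of the latter is nonempty and determines where the original cube lies. *)
Lemma neighbor_inj l F u : cube_family l F -> set_inj F (fun Q => neighbor Q u).
Proof.
move=> lF Q Q' /set_mem FQ /set_mem FQ' QQ'.
have [y yQ] := interior_cube_neq0 (neighbor Q u).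
by apply: (neighbor_same_interior lF FQ FQ' yQ); rewrite -QQ'.
Qed.

Lemma neighbor_family l F u : cube_family l F ->
  cube_family l ((fun Q => neighbor Q u) @` F).
Proof.
move=> lF; split=> [_ [Q FQ <-]|]; first by rewrite edge_neighbor; exact: lF.1.
move=> _ _ [Q FQ <-] [Q' FQ' <-] [y [yQ yQ']].
by rewrite (neighbor_same_interior lF FQ FQ' yQ yQ').
Qed.

End translated_families.

Section family_norm.
Local Open Scope ereal_scope.
Context {R : realType} {n : nat}.
Local Notation mu := (@lebesgue_n R n).
Implicit Types (Q : cube R n) (F : set (cube R n)) (A B : cube R n -> \bar R).

(** The operation that both norms apply to a function of cubes, with
    [r = p / q]. *)
Definition family_norm (p r : R) A : \bar R :=
  ereal_sup [set (\esum_(Q in F) mu Q * A Q `^ r) `^ p^-1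
    | F in [set F | exists2 l : R, (0 < l)%R & cube_family l F]].

Lemma poweR_le (r : R) (x y : \bar R) : (0 <= r)%R -> 0 <= x -> x <= y ->
  x `^ r <= y `^ r.
Proof.
move=> r0 x0 xy; apply: gt0_ler_poweR; rewrite ?in_itv//= ?leey ?andbT//.
exact: le_trans xy.
Qed.

(** The sum is at most the number of terms times the largest term. *)
Lemma sum_poweR_le (U : finType) (u0 : U) (r : R) (b : U -> \bar R) : (0 < r)%R ->
  (forall u, 0 <= b u) ->
  (\sum_(u : U) b u) `^ r <= (#|U|%:R `^ r)%:E * \sum_(u : U) b u `^ r.
Proof.
move=> r0 b0; have [w _ wmax] := @arg_maxP _ _ U u0 xpredT b isT.
have cstE : \sum_(u : U) b w = #|U|%:R%:E * b w.
  under eq_bigr do rewrite -[b w]mul1e.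
  by rewrite -ge0_sume_distrl// sumEFin sumr_const.
apply: (@le_trans _ _ ((#|U|%:R%:E * b w) `^ r)).
  apply: poweR_le; [exact: ltW|exact: sume_ge0|].
  by rewrite -cstE; apply: lee_sum => u _; exact: wmax.
rewrite poweRM// poweR_EFin lee_wpmul2l ?lee_fin ?powR_ge0//.
by rewrite (bigD1 w)//= leeDl// sume_ge0// => u _; exact: poweR_ge0.
Qed.

Lemma esum_le_scale (I : choiceType) (P : set I) (a b : I -> \bar R) (c : R) :
  (0 <= c)%R -> (forall i, 0 <= a i) -> (forall i, 0 <= b i) ->
  (forall i, P i -> a i <= c%:E * b i) ->
  \esum_(i in P) a i <= c%:E * \esum_(i in P) b i.
Proof.
move=> c0 a0 b0 ab; apply: ge_ereal_sup => _ [D [finD DP] <-].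
apply: (@le_trans _ _ (c%:E * \sum_(i \in D) b i)).
  rewrite ge0_mule_fsumr//; apply: lee_fsum => // i Di.
  by apply: ab; exact: DP.
rewrite lee_wpmul2l ?lee_fin//; apply: ereal_sup_ubound.
by exists D.
Qed.

Lemma family_norm_ge0 (p r : R) A : 0 <= family_norm p r A.
Proof.
apply: le_trans (poweR_ge0 (\esum_(Q in (set0 : set (cube R n))) mu Q * A Q `^ r) p^-1) _.
apply: ereal_sup_ubound; exists set0 => //; exists 1%R => //.
by split => [Q []|Q Q' []].
Qed.

(** For each [u] the cubes [phi u Q] form an admissible family of cubes of the
    same measure, so the sum over them is at most the [p]-th power of the norm
    of [B]. *)
Lemma family_norm_le (U : finType) (u0 : U) (phi : U -> cube R n -> cube R n)
    (p r c : R) A B :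
  (0 < p)%R -> (0 < r)%R -> (0 <= c)%R ->
  (forall Q, 0 <= A Q) -> (forall Q, 0 <= B Q) ->
  (forall u Q, edge (phi u Q) = edge Q) ->
  (forall u l F, cube_family l F -> cube_family l (phi u @` F) /\ set_inj F (phi u)) ->
  (forall Q, A Q <= c%:E * \sum_(u : U) B (phi u Q)) ->
  family_norm p r A <=
  (((c * #|U|%:R) `^ r * #|U|%:R) `^ p^-1)%:E * family_norm p r B.
Proof.
move=> p0 r0 c0 A0 B0 ephi Fphi AB.
set X := family_norm p r B; have X0 : 0 <= X by exact: family_norm_ge0.
set M : R := #|U|%:R; have M0 : (0 <= M)%R by exact: ler0n.
have d0 : (0 <= (c * M) `^ r)%R by exact: powR_ge0.
have muphi u Q : mu (phi u Q) = mu Q.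
  by rewrite (lebesgue_cube (phi u Q)) (lebesgue_cube Q) ephi.
have term0 C Q : 0 <= mu Q * C Q `^ r by rewrite mule_ge0// poweR_ge0.
apply: ge_ereal_sup => _ [F [l l0 lF] <-].
have sumX u : \esum_(Q in F) mu Q * B (phi u Q) `^ r <= X `^ p.
  have [lF' injF] := Fphi u l F lF.
  have -> : \esum_(Q in F) mu Q * B (phi u Q) `^ r =
            \esum_(Q in phi u @` F) mu Q * B Q `^ r.
    by rewrite (esum_image F (phi u) _ injF); apply: eq_esum => Q _; rewrite muphi.
  set S := \esum_(_ in _) _; have S0 : 0 <= S by exact: esum_ge0.
  have -> : S = (S `^ p^-1) `^ p by rewrite -poweRrM mulVf ?gt_eqF// poweRe1.
  apply: poweR_le; [exact: ltW|exact: poweR_ge0|].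
  by apply: ereal_sup_ubound; exists (phi u @` F) => //; exists l.
have sumA : \esum_(Q in F) mu Q * A Q `^ r <= ((c * M) `^ r * M)%:E * X `^ p.
  apply: (@le_trans _ _ (((c * M) `^ r)%:E *
      \esum_(Q in F) \sum_(u : U) mu Q * B (phi u Q) `^ r)).
    apply: esum_le_scale => // [Q|Q _].
      by apply: sume_ge0 => u _; rewrite mule_ge0// poweR_ge0.
    rewrite -ge0_sume_distrr; last by move=> u _; exact: poweR_ge0.
    rewrite muleCA lee_wpmul2l//.
    apply: (@le_trans _ _ ((c%:E * \sum_(u : U) B (phi u Q)) `^ r)).
      by apply: poweR_le => //; exact: ltW.
    rewrite poweRM//; last exact: sume_ge0.
    rewrite poweR_EFin powRM// EFinM -muleA lee_wpmul2l ?lee_fin ?powR_ge0//.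
    exact: sum_poweR_le.
  rewrite EFinM -muleA lee_wpmul2l ?lee_fin//.
  rewrite esum_sum; last by move=> Q u _ _; rewrite mule_ge0// poweR_ge0.
  apply: (@le_trans _ _ (\sum_(u : U) X `^ p)); first by apply: lee_sum.
  under eq_bigr do rewrite -[X `^ p]mul1e.
  by rewrite -ge0_sume_distrl// sumEFin sumr_const.
apply: (@le_trans _ _ ((((c * M) `^ r * M)%:E * X `^ p) `^ p^-1)).
  by apply: poweR_le => //; [rewrite invr_ge0 ltW|exact: esum_ge0].
rewrite poweRM ?poweR_ge0 ?lee_fin ?mulr_ge0// poweR_EFin -poweRrM.
by rewrite divff ?gt_eqF// poweRe1.
Qed.

Lemma JNQ_normE (p q alpha : R) (f : Rn R n -> \bar R) :
  JNQ_norm p q alpha f = family_norm p (p / q) (frac_energy q alpha f).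
Proof. by []. Qed.

Lemma tJNQ_normE (p q alpha : R) (f : Rn R n -> \bar R) :
  tJNQ_norm p q alpha f = family_norm p (p / q) (Psi_pow q alpha f).
Proof.
congr ereal_sup; apply: eq_imagel => F _; congr (_ `^ _); apply: eq_esum => Q _.
by rewrite /Psi -/(Psi_pow q alpha f Q) -poweRrM mulrC.
Qed.

End family_norm.

Local Open Scope ereal_scope.

Theorem theorem3p1 (R : realType) (n : nat) (p q alpha : R)
    (hn : (0 < n)%N) (hq : (1 <= q)%R) (hqp : (q <= p)%R) :
  (forall f : Rn R n -> \bar R,
     JNQ p q alpha f <->
     ae_finite_measurable f /\ tJNQ_norm p q alpha f < +oo) /\
  exists C1 C2 : R, [/\ (0 < C1)%R, (0 < C2)%R &
    forall f : Rn R n -> \bar R, ae_finite_measurable f ->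
      tJNQ_norm p q alpha f <= C1%:E * JNQ_norm p q alpha f /\
      JNQ_norm p q alpha f <= C2%:E * tJNQ_norm p q alpha f].
Proof.
have q0 : (0 < q)%R by exact: lt_le_trans hq.
have p0 : (0 < p)%R by exact: lt_le_trans hqp.
have r0 : (0 < p / q)%R by rewrite divr_gt0.
pose U := option {ffun 'I_n -> bool * bool}.
pose k1 := Psi_constant n q alpha.
pose k2 : R := (kernel_constant n q alpha * (2 `^ q * 2))%R.
have k10 : (0 < k1)%R by exact: Psi_constant_gt0.
have k20 : (0 < k2)%R by rewrite !mulr_gt0 ?powR_gt0// kernel_constant_gt0.
have U0 : (0 < #|{: U}|%:R :> R)%R by rewrite ltr0n; apply/card_gt0P; exists None.
pose C1 : R := (((k1 * #|{: unit}|%:R) `^ (p / q) * #|{: unit}|%:R) `^ p^-1)%R.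
pose C2 : R := (((k2 * #|{: U}|%:R) `^ (p / q) * #|{: U}|%:R) `^ p^-1)%R.
have pos (c m : R) : (0 < c -> 0 < m -> 0 < ((c * m) `^ (p / q) * m) `^ p^-1)%R.
  by move=> c0 m0; rewrite powR_gt0// mulr_gt0// powR_gt0// mulr_gt0.
have C10 : (0 < C1)%R by apply: pos; rewrite ?card_unit.
have C20 : (0 < C2)%R by exact: pos.
have equiv (f : Rn R n -> \bar R) : ae_finite_measurable f ->
    tJNQ_norm p q alpha f <= C1%:E * JNQ_norm p q alpha f /\
    JNQ_norm p q alpha f <= C2%:E * tJNQ_norm p q alpha f.
  move=> [mf _]; rewrite JNQ_normE tJNQ_normE.
  have fe0 Q : 0 <= frac_energy q alpha f Q by exact: frac_energy_ge0.
  have Psi0 Q : 0 <= Psi_pow q alpha f Q by exact: Psi_pow_ge0.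
  split.
  - apply: (@family_norm_le R n unit tt (fun _ => id)) => //; first exact: ltW.
    + by move=> _ l F lF; rewrite image_id; split => // ? ? _ _.
    + move=> Q; rewrite (big_pred1 tt); last by case.
      exact: Psi_pow_le_frac_energy.
  - apply: (@family_norm_le R n U None (fun u Q => neighbor Q u)) => //.
    + exact: ltW.
    + by move=> u Q; exact: edge_neighbor.
    + by move=> u l F lF; split; [exact: neighbor_family|exact: neighbor_inj lF].
    + by move=> Q; exact: frac_energy_le_Psi_pow.
split; last by exists C1, C2.
move=> f; split=> [] [fm fin]; split => //; have [h1 h2] := equiv f fm.
- by apply: le_lt_trans h1 _; rewrite lte_mul_pinfty ?lee_fin ?ltW.
- by apply: le_lt_trans h2 _; rewrite lte_mul_pinfty ?lee_fin ?ltW.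
Qed.
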